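(* Let $U$ be an open connected subset of $\mathbb{R}$, let $V$ be an open subset of some Euclidean space $\mathbb{R}^l$, let $h:V\times U\to\mathbb{R}$ be a smooth function, and let $v={}^{\circ}v+\delta v\in{}^{\bullet}V$ be a fixed point with $\delta v\neq0$. Let $g:{}^{\bullet}U\to{}^{\bullet}\mathbb{R}$ be the quasi-standard smooth function defined by $g(x)={}^{\bullet}h(v,x)$. Assume that for each $x\in{}^{\bullet}U$ there exists $m=m(x)\in\mathbb{Z}^{>0}$ such that $D^{(0,m)}h({}^{\circ}v,{}^{\circ}x)\neq0$, and write $m_x$ for the smallest such $m$ (it depends only on ${}^{\circ}x$). If for every $x\in{}^{\bullet}U$ one has $D^{a}h({}^{\circ}v,{}^{\circ}x)=0$ for every multi-index $a=(a_v,a_x)\in\mathbb{N}^l\times\mathbb{N}$ with $0<a_x<m_x$, then $g$ has the intermediate value property.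
   Context: Fermat reals: for $U\subseteq\mathbb{R}^n$ open, a little-oh polynomial on $U$ is a function $x:[0,\epsilon)\to U$ ($\epsilon>0$ depending on $x$) such that $x(t)=r+\sum_{i=1}^k\alpha_i t^{a_i}+o(t)$ as $t\to0^+$ for some $k\in\mathbb{N}$, $\alpha_i\in\mathbb{R}^n$, $a_i>0$, with $r=x(0)\in U$. Two such $x,y$ are equivalent if $x(0)=y(0)$ and $x(t)-y(t)=o(t)$; the quotient set is ${}^{\bullet}U$. Every $x\in{}^{\bullet}U$ is uniquely of the form $x={}^{\circ}x+\sum_{i=1}^l\beta_i t^{b_i}$ with ${}^{\circ}x\in U$ (standard part), $\beta_i\in\mathbb{R}^n\setminus\{0\}$, $0<b_1<\cdots<b_l\le1$; allowing $\beta_i=0$ gives a quasi-decomposition. The infinitesimal part is $\delta x=x-{}^{\circ}x$. ${}^{\bullet}\mathbb{R}$ is a commutative unital ring under pointwise operations; ${}^{\bullet}(\prod U_i)$ is identified with $\prod{}^{\bullet}U_i$. ${}^{\bullet}\mathbb{R}$ is totally ordered: writing $x={}^{\circ}x+\sum_{i=1}^n\alpha_it^{a_i}$, $y={}^{\circ}y+\sum_{i=1}^n\beta_it^{a_i}$ with common exponents $0<a_1<\cdots<a_n\le1$, $x\le y$ iff $({}^{\circ}x,\alpha_1,\ldots,\alpha_n)\le({}^{\circ}y,\beta_1,\ldots,\beta_n)$ lexicographically. For a smooth map $f:U\to W$ of open subsets of Euclidean spaces, ${}^{\bullet}f:{}^{\bullet}U\to{}^{\bullet}W$ is ${}^{\bullet}f([x])=[f\circ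 x]$. For a multi-index $a=(a_v,a_x)\in\mathbb{N}^l\times\mathbb{N}$, $D^ah$ is the partial derivative of $h$ of order $a_v$ in the $V$-variables and $a_x$ in the $U$-variable; $D^{(0,m)}h$ is the $m$-th partial derivative in the $U$-variable. A function $g:{}^{\bullet}U\to{}^{\bullet}\mathbb{R}$ ($U\subseteq\mathbb{R}$ open connected) has the intermediate value property if for all $a,b\in{}^{\bullet}U$ with $a<b$ and every $y\in{}^{\bullet}\mathbb{R}$ between $g(a)$ and $g(b)$, there is $c\in{}^{\bullet}\mathbb{R}$ between $a$ and $b$ with $g(c)=y$. *)

(* Defs.v *)
From HB Require Import structures.
From mathcomp Require Import all_boot all_order all_algebra.
From mathcomp Require Import all_classical all_reals all_analysis.

Set Implicit Arguments.
Unset Strict Implicit.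
Unset Printing Implicit Defensive.

Import Order.TTheory GRing.Theory Num.Theory.
Import numFieldNormedType.Exports.

Local Open Scope classical_set_scope.
Local Open Scope ring_scope.
Local Open Scope quotient_scope.

Section FermatReals.
Context {R : realType}.

Definition puiseux {E : normedModType R} (n : nat) (r : E) (a : n.-tuple R)
    (alpha : n.-tuple E) (t : R) : E :=
  r + \sum_(i < n) t `^ tnth a i *: tnth alpha i.

(* A function on [0, e) is encoded as a total function on R, whose values
   outside of [0, e) are irrelevant: neither [is_lop] nor [lop_equiv] depends
   on them. *)
Definition is_lop {E : normedModType R} (U : set E) (x : R -> E) : Prop :=
  (exists2 e : R, 0 < e & forall t, 0 <= t < e -> U (x t)) /\
  exists (k : nat) (a : k.-tuple R) (alpha : k.-tuple E),
    (forall i, 0 < tnth a i) /\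
    (fun t => x t - puiseux (x 0) a alpha t) =o_ (0^'+) id.

Definition lop_equiv {E : normedModType R} (x y : R -> E) : Prop :=
  x 0 = y 0 /\ (fun t => x t - y t) =o_ (0^'+) id.

Section Quotient.
Context {E : normedModType R}.

Record lop (U : set E) :=
  Lop { lop_val :> R -> E; lopP : `[< is_lop U lop_val >] }.

HB.instance Definition _ (U : set E) := [isSub for @lop_val U].
HB.instance Definition _ (U : set E) := [Choice of lop U by <:].

Lemma lop_equiv_refl (x : R -> E) : lop_equiv x x.
Proof.
split=> //; apply/eqoP => e e0; near=> t.
by rewrite subrr normr0 mulr_ge0// ltW.
Unshelve. all: by end_near. Qed.

Lemma lop_equiv_sym (x y : R -> E) : lop_equiv x y -> lop_equiv y x.
Proof.
move=> [xy0 /eqoP xy]; split=> //; apply/eqoP => e e0.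
by have := xy _ e0; apply: filterS => t; rewrite distrC.
Qed.

Lemma lop_equiv_trans (y x z : R -> E) :
  lop_equiv x y -> lop_equiv y z -> lop_equiv x z.
Proof.
move=> [xy0 /eqoP xy] [yz0 /eqoP yz]; split; first by rewrite xy0.
apply/eqoP => e e0; have e20 : 0 < e / 2 by rewrite divr_gt0.
have := xy _ e20; apply: filterS2 (yz _ e20) => t yzt xyt.
rewrite -(subrKA (y t)) (le_trans (ler_normD _ _))//.
by rewrite (splitr e) mulrDl lerD.
Qed.

Definition lop_eq (U : set E) : rel (lop U) := fun x y => `[< lop_equiv x y >].

Lemma lop_eq_equiv (U : set E) : equiv_class_of (@lop_eq U).
Proof.
split.
- by move=> x; apply/asboolP/lop_equiv_refl.
- by move=> x y; apply/asboolP/asboolP => /lop_equiv_sym.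
- move=> y x z /asboolP xy /asboolP yz; apply/asboolP.
  exact: lop_equiv_trans xy yz.
Qed.

Canonical lop_eq_equivRel (U : set E) := EquivRelPack (lop_eq_equiv U).

Definition fermat (U : set E) := {eq_quot (@lop_eq_equivRel U)}.

HB.instance Definition _ (U : set E) := Choice.on (fermat U).
HB.instance Definition _ (U : set E) := EqQuotient.on (fermat U).

Definition std_part (U : set E) (x : fermat U) : E := repr x 0.

Lemma is_lop_cst (r : E) : is_lop [set: E] (fun=> r).
Proof.
split; first by exists 1.
exists 0, [tuple], [tuple]; split=> [[]//|].
apply/eqoP => e e0; near=> t.
by rewrite /puiseux big_ord0 addr0 subrr normr0 mulr_ge0// ltW.
Unshelve. all: by end_near. Qed.

Definition fermat_cst (r : E) : fermat [set: E] :=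
  \pi_(fermat [set: E]) (Lop (asboolT (is_lop_cst r))).

Lemma is_lop_inf_part (U : set E) (x : lop U) :
  is_lop [set: E] (fun t => x t - x 0).
Proof.
case: x => x /= /asboolP[_ [k [a [alpha [a0 xE]]]]].
split; first by exists 1.
exists k, a, alpha; split=> //.
suff -> : (fun t => x t - x 0 - puiseux (x 0 - x 0) a alpha t) =
  (fun t => x t - puiseux (x 0) a alpha t) by [].
by apply/funext => t; rewrite /puiseux subrr add0r opprD addrA.
Qed.

Definition inf_part (U : set E) (x : fermat U) : fermat [set: E] :=
  \pi_(fermat [set: E]) (Lop (asboolT (is_lop_inf_part (repr x)))).

End Quotient.

Lemma is_lop_pair {E F : normedModType R} (U : set E) (W : set F)
    (x : lop U) (y : lop W) : is_lop (U `*` W) (fun t => (x t, y t)).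
Proof.
case: x y => [x /asboolP] /= [[d d0 xU] [k [a [al [a0 /eqoP xE]]]]].
case=> [y /asboolP] /= [[e e0 yW] [m [b [be [b0 /eqoP yE]]]]].
split.
  exists (Num.min d e); first by rewrite lt_min d0.
  move=> t /andP[t0]; rewrite lt_min => /andP[td te].
  by split; [apply: xU|apply: yW]; rewrite t0.
exists (k + m)%N, [tuple of a ++ b].
exists [tuple of [tuple of [seq (u, 0) | u <- al]] ++
                 [tuple of [seq (0, u) | u <- be]]].
split=> [i|].
  rewrite (tnth_nth 0) /= nth_cat size_tuple.
  case: ltnP => ik; first by rewrite -(tnth_nth 0 a (Ordinal ik)).
  have im : (i - k < m)%N by rewrite ltn_subLR.
  by rewrite -(tnth_nth 0 b (Ordinal im)).
apply/eqoP => c c0; apply: filterS2 (xE _ c0) (yE _ c0) => t xt yt.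
suff -> : puiseux (x 0, y 0) [tuple of a ++ b]
    [tuple of [tuple of [seq (u, 0) | u <- al]] ++
              [tuple of [seq (0, u) | u <- be]]] t =
    (puiseux (x 0) a al t, puiseux (y 0) b be t).
  by rewrite prod_normE ge_max xt.
rewrite /puiseux big_split_ord /=.
rewrite (eq_bigr (fun i => (t `^ tnth a i *: tnth al i, 0))); last first.
  by move=> i _; rewrite !tnth_lshift tnth_map; congr pair; rewrite scaler0.
rewrite [X in _ + (_ + X)](eq_bigr (fun i => (0, t `^ tnth b i *: tnth be i)));
    last first.
  by move=> i _; rewrite !tnth_rshift tnth_map; congr pair; rewrite scaler0.
have pE n1 (f : 'I_n1 -> E) :
    \sum_(i < n1) (f i, 0 : F) = (\sum_(i < n1) f i, 0).
  by apply: (big_ind2 (fun u w => u = (w, 0))) => // _ u1 _ u2 -> ->;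
    congr pair; rewrite addr0.
have pF n1 (f : 'I_n1 -> F) :
    \sum_(i < n1) (0 : E, f i) = (0, \sum_(i < n1) f i).
  by apply: (big_ind2 (fun u w => u = (0, w))) => // _ u1 _ u2 -> ->;
    congr pair; rewrite addr0.
by rewrite pE pF; congr pair; rewrite /= ?addr0 ?add0r.
Qed.

(* The identification of the product of the extensions with the extension of
   the product. *)
Definition fermat_pair {E F : normedModType R} (U : set E) (W : set F)
    (x : fermat U) (y : fermat W) : fermat (U `*` W) :=
  \pi_(fermat (U `*` W)) (Lop (asboolT (is_lop_pair (repr x) (repr y)))).

(* [x] |-> [f \o x].  The composite is a little-oh polynomial whenever f is
   smooth on the open set U, by Taylor's formula; [insubd] falls back to the
   zero function otherwise. *)
Definition fermat_ext {E : normedModType R} (U : set E) (f : E -> R)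
    (x : fermat U) : fermat [set: R] :=
  \pi_(fermat [set: R])
    (insubd (Lop (asboolT (is_lop_cst (0 : R)))) (f \o repr x)).

(* A common quasi-decomposition of x and y exists and the outcome of the
   comparison does not depend on it. *)
Definition fermat_le {U : set R} (x y : fermat U) : Prop :=
  exists (n : nat) (a alpha beta : n.-tuple R),
    [/\ sorted <%R a, (forall i, 0 < tnth a i <= 1),
        lop_equiv (repr x) (puiseux (std_part x) a alpha),
        lop_equiv (repr y) (puiseux (std_part y) a beta) &
        ((std_part x :: alpha : seqlexi R) <= (std_part y :: beta : seqlexi R))%O].

Definition fermat_lt {U : set R} (x y : fermat U) : Prop :=
  fermat_le x y /\ x <> y.

Definition fermat_between {U : set R} (a b c : fermat U) : Prop :=
  (fermat_le a c /\ fermat_le c b) \/ (fermat_le b c /\ fermat_le c a).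

Definition intermediate_value_property (U : set R)
    (g : fermat U -> fermat [set: R]) : Prop :=
  forall a b : fermat U, fermat_lt a b ->
  forall y : fermat [set: R], fermat_between (g a) (g b) y ->
  exists2 c : fermat U, fermat_between a b c & g c = y.

Section Derivatives.
Context {l : nat}.

(* The coordinates of R^l * R: [Some i] is the i-th coordinate of R^l and
   [None] the last coordinate. *)
Definition coord_dir (o : option 'I_l) : 'rV[R]_l * R :=
  if o is Some i then (delta_mx 0 i, 0) else (0, 1).

Definition partial (o : option 'I_l) (f : 'rV[R]_l * R -> R) :
  'rV[R]_l * R -> R := fun z => 'D_(coord_dir o) f z.

(* Partial derivatives of all orders, in any order of differentiation, exist
   and are continuous on D; only used for D open. *)
Definition smooth_on (D : set ('rV[R]_l * R)) (f : 'rV[R]_l * R -> R) : Prop :=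
  forall (w : seq (option 'I_l)) (z : 'rV[R]_l * R), D z ->
    {for z, continuous (foldr partial f w)} /\
    forall o, derivable (foldr partial f w) z (coord_dir o).

(* The derivative of multi-index (av, ax). *)
Definition mderiv (av : 'I_l -> nat) (ax : nat) (f : 'rV[R]_l * R -> R) :
    'rV[R]_l * R -> R :=
  foldr (fun i => iter (av i) (partial (Some i))) (iter ax (partial None) f)
    (enum 'I_l).

Definition last_deriv (m : nat) (f : 'rV[R]_l * R -> R) :=
  mderiv (fun=> 0%N) m f.

Definition is_first_order (f : 'rV[R]_l * R -> R) (z : 'rV[R]_l * R)
    (m : nat) : Prop :=
  [/\ (0 < m)%N, last_deriv m f z != 0 &
      forall k, (0 < k)%N -> last_deriv k f z != 0 -> (m <= k)%N].

End Derivatives.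

End FermatReals.

(* Main.v *)
Require Import Defs.
From mathcomp Require Import all_boot all_order all_algebra.
From mathcomp Require Import all_classical all_reals all_analysis.
From mathcomp Require Import ring lra.
Import numFieldNormedType.Exports.

(** Write F t x = h (v t, x).  Everything is computed on representatives modulo
    o(t), where the functions sum_i c_i t^(a_i) + o(t) form a ring totally ordered
    by eventual comparison.  At a standard point r of order m, the vanishing of the
    mixed derivatives of order 0 < a_x < m makes the Taylor coefficients of
    u^1, ..., u^(m-1) in F t (r + u) negligible, so that
      F t (r + u) = F t r + sum_(i <= n) p_i(t) u^(m + i)
    modulo o(t) and O(u^(m + n + 1)), with p_0(0) <> 0.  Extracting the leading
    power of t turns the equation "right-hand side = y" into one with a simple root,
    which Newton's iteration solves modulo o(t); since the polynomial is
    monotone in u on each side of 0, the root lies between two given infinitesimal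
    bounds as soon as y lies between their values.  When the standard parts A < B
    of the end points differ, take for r the supremum of the standard x in [A, B]
    with h (v 0, x) < y(0): finite order forces a sign change at r (or one of the
    end points is such an r), and the displacements -t^d and t^d with d small bound
    a root in the monad of r. *)

Set Implicit Arguments.
Unset Strict Implicit.
Unset Printing Implicit Defensive.

Import Order.TTheory GRing.Theory Num.Theory.

Local Open Scope classical_set_scope.
Local Open Scope ring_scope.

(** * Generalized power series modulo o(t) *)

Section GermsAtZero.
Context {R : realType}.
Implicit Types (f g x y z : R -> R) (p q : seq (R * R)).

(** Two precisions are in play. Elements of the ring are known only modulo o(t). This suffices for
    comparing them and for substituting into [h], but not for dividing by a power of t, as rescaling
    an equation to its leading order requires. Coefficients are therefore replaced by exact
    generalized polynomials before rescaling, and the o(t) errors are taken into account again only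
    after multiplying back. A second obstacle is that F t need not be monotone across r, since m may
    be even. The two sides of r are treated apart, and comparing y with F t r selects one of them.
    Negating F and reflecting x reduce every local statement to a positive leading coefficient and
    nonnegative displacements. Flatness matters because a surviving coefficient of u^j with 0 < j <
    m could, even if infinitesimal, outweigh p_0 u^m for infinitesimal u and break the
    monotonicity. *)

Lemma near0_gt : \forall t \near (0 : R)^'+, 0 < t.
Proof. exact: nbhs_right_gt. Qed.

Lemma near0_lt (c : R) : 0 < c -> \forall t \near (0 : R)^'+, t < c.
Proof. by move=> c0; exact: nbhs_right_lt. Qed.

Lemma near0_pow_le (a c : R) : 0 < a -> 0 < c ->
  \forall t \near (0 : R)^'+, t `^ a <= c.
Proof.
move=> a0 c0; have /cvgrPdist_le/(_ c c0) := powR_cvg0 a0.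
by apply: filterS => t; rewrite sub0r normrN ger0_norm ?powR_ge0.
Qed.

Lemma powRD_gt0 (t a b : R) : 0 < t -> t `^ (a + b) = t `^ a * t `^ b.
Proof. by move=> t0; rewrite powRD// (gt_eqF t0) implybT. Qed.

Definition negl f := forall e : R, 0 < e ->
  \forall t \near (0 : R)^'+, `|f t| <= e * t.

Definition meq f g := negl (fun t => f t - g t).

(** No sign is imposed on C; proofs pass to [|C| + 1] whenever they divide by the constant. *)
Definition powO (e : R) f := exists C : R,
  \forall t \near (0 : R)^'+, `|f t| <= C * t `^ e.

Definition bnd f := exists C : R, \forall t \near (0 : R)^'+, `|f t| <= C.

Lemma neglP f : negl f <-> f =o_ (0^'+) id.
Proof.
split=> [h|/eqoP h].
  apply/eqoP => e e0; apply: filterS2 near0_gt (h e e0) => t t0.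
  by rewrite (gtr0_norm t0).
move=> e e0; apply: filterS2 near0_gt (h e e0) => t t0.
by rewrite (gtr0_norm t0).
Qed.

Lemma negl_near f g : (\forall t \near (0 : R)^'+, f t = g t) ->
  negl f -> negl g.
Proof. by move=> fg h e /h; apply: filterS2 fg => t ->. Qed.

Lemma negl0 : negl (fun=> 0).
Proof.
move=> e e0; apply: filterS near0_gt => t t0.
by rewrite normr0 mulr_ge0// ltW.
Qed.

Lemma neglD f g : negl f -> negl g -> negl (fun t => f t + g t).
Proof.
move=> hf hg e e0; have e2 : 0 < e / 2 by rewrite divr_gt0.
apply: filterS2 (hf _ e2) (hg _ e2) => t ft gt.
by rewrite (le_trans (ler_normD _ _))// (splitr e) mulrDl lerD.
Qed.

Lemma neglM f g : negl f -> bnd g -> negl (fun t => f t * g t).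
Proof.
move=> hf [C hg] e e0; have C1 : 0 < `|C| + 1 by rewrite ltr_wpDl.
apply: filterS3 near0_gt hg (hf _ (divr_gt0 e0 C1)) => t t0 gt ft.
have {}gt : `|g t| <= `|C| + 1.
  by rewrite (le_trans gt)// (le_trans (ler_norm C))// lerDl.
rewrite normrM; apply: (le_trans (ler_pM _ _ ft gt)) => //.
by rewrite mulrAC divfK// gt_eqF.
Qed.

Lemma bnd_cst c : bnd (fun=> c).
Proof. by exists `|c|; near=> t. Unshelve. all: by end_near. Qed.

Lemma neglN f : negl f -> negl (fun t => - f t).
Proof. by move=> h e /h; apply: filterS => t; rewrite normrN. Qed.

Lemma negl_le f g : (\forall t \near (0 : R)^'+, `|f t| <= `|g t|) ->
  negl g -> negl f.
Proof. by move=> fg h e /h; apply: filterS2 fg => t; exact: le_trans. Qed.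

Lemma meq_refl f : meq f f.
Proof. by rewrite /meq; under eq_fun do rewrite subrr; exact: negl0. Qed.

Lemma meq_sym f g : meq f g -> meq g f.
Proof. by move=> /neglN; apply: negl_near; near=> t; rewrite opprB.
Unshelve. all: by end_near. Qed.

Lemma meq_trans g f h : meq f g -> meq g h -> meq f h.
Proof.
move=> fg gh; apply: negl_near (neglD fg gh); near=> t; ring.
Unshelve. all: by end_near. Qed.

Lemma meq_near f g : (\forall t \near (0 : R)^'+, f t = g t) -> meq f g.
Proof.
move=> fg; apply: negl_near negl0; apply: filterS fg => t ->.
by rewrite subrr.
Qed.

Lemma meqD f1 g1 f2 g2 : meq f1 g1 -> meq f2 g2 ->
  meq (fun t => f1 t + f2 t) (fun t => g1 t + g2 t).
Proof.
move=> h1 h2; apply: negl_near (neglD h1 h2); near=> t; ring.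
Unshelve. all: by end_near. Qed.

Lemma meqN f g : meq f g -> meq (fun t => - f t) (fun t => - g t).
Proof.
by move=> /neglN; apply: negl_near; near=> t; rewrite opprB opprK addrC.
Unshelve. all: by end_near. Qed.

Lemma meqM f1 g1 f2 g2 : bnd f1 -> bnd g2 -> meq f1 g1 -> meq f2 g2 ->
  meq (fun t => f1 t * f2 t) (fun t => g1 t * g2 t).
Proof.
move=> b1 b2 h1 h2.
apply: negl_near (neglD (neglM h2 b1) (neglM h1 b2)); near=> t; ring.
Unshelve. all: by end_near. Qed.

Lemma negl_bnd f : negl f -> bnd f.
Proof.
move=> h; exists 1; apply: filterS2 (h 1 ltr01) (near0_lt ltr01) => t.
by rewrite mul1r => h1 /ltW; exact: le_trans.
Qed.

Lemma bndD f g : bnd f -> bnd g -> bnd (fun t => f t + g t).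
Proof.
move=> [C hf] [D hg]; exists (C + D); apply: filterS2 hf hg => t ft gt.
by rewrite (le_trans (ler_normD _ _))// lerD.
Qed.

Lemma bndM f g : bnd f -> bnd g -> bnd (fun t => f t * g t).
Proof.
move=> [C hf] [D hg]; exists (C * D); apply: filterS2 hf hg => t ft gt.
by rewrite normrM ler_pM.
Qed.

Lemma bndX f n : bnd f -> bnd (fun t => f t ^+ n).
Proof.
move=> bf; elim: n => [|n IH].
  by under eq_fun do rewrite expr0; exact: bnd_cst.
by under eq_fun do rewrite exprS; exact: bndM.
Qed.

Lemma bnd_near f g : (\forall t \near (0 : R)^'+, f t = g t) -> bnd f -> bnd g.
Proof. by move=> fg [C h]; exists C; apply: filterS2 fg h => t ->. Qed.

Lemma bnd_meq f g : meq f g -> bnd f -> bnd g.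
Proof.
move=> /meq_sym/negl_bnd fg bf; apply: bnd_near (bndD bf fg).
by near=> t; ring.
Unshelve. all: by end_near. Qed.

Lemma meq_sum (I : Type) (s : seq I) (P : pred I) (F G : I -> R -> R) :
  (forall i, P i -> meq (F i) (G i)) ->
  meq (fun t => \sum_(i <- s | P i) F i t) (fun t => \sum_(i <- s | P i) G i t).
Proof.
move=> FG; elim: s => [|i s IH].
  by rewrite /meq; under eq_fun do rewrite !big_nil subrr; exact: negl0.
rewrite /meq; under eq_fun do rewrite !big_cons.
by case: (boolP (P i)) => // Pi; exact: meqD (FG i Pi) IH.
Qed.

Lemma negl_sum (I : Type) (s : seq I) (P : pred I) (F : I -> R -> R) :
  (forall i, P i -> negl (F i)) -> negl (fun t => \sum_(i <- s | P i) F i t).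
Proof.
move=> FG; elim: s => [|i s IH].
  by under eq_fun do rewrite big_nil; exact: negl0.
under eq_fun do rewrite big_cons.
by case: (boolP (P i)) => // Pi; exact: neglD (FG i Pi) IH.
Qed.

Lemma meqX f g n : bnd f -> meq f g ->
  meq (fun t => f t ^+ n) (fun t => g t ^+ n).
Proof.
move=> bf fg; have bg := bnd_meq fg bf; elim: n => [|n IH].
  by rewrite /meq; under eq_fun do rewrite !expr0 subrr; exact: negl0.
rewrite /meq; under eq_fun do rewrite !exprS.
by apply: meqM => //; exact: bndX.
Qed.

Lemma powO_le e e' f : e' <= e -> powO e f -> powO e' f.
Proof.
move=> ee' [C h]; exists `|C|.
apply: filterS3 near0_gt (near0_lt ltr01) h => t t0 /ltW t1 /le_trans; apply.
apply: (@le_trans _ _ (`|C| * t `^ e)).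
  by rewrite ler_wpM2r ?powR_ge0// ler_norm.
by rewrite ler_wpM2l// ger_powR// t0.
Qed.

Lemma powOD e f g : powO e f -> powO e g -> powO e (fun t => f t + g t).
Proof.
move=> [C hf] [D hg]; exists (C + D); apply: filterS2 hf hg => t ft gt.
by rewrite (le_trans (ler_normD _ _))// mulrDl lerD.
Qed.

Lemma powOM e e' f g : powO e f -> powO e' g ->
  powO (e + e') (fun t => f t * g t).
Proof.
move=> [C hf] [D hg]; exists (C * D).
apply: filterS3 near0_gt hf hg => t t0 ft gt.
by rewrite normrM powRD_gt0// mulrACA ler_pM.
Qed.

Lemma bnd_powO0 f : bnd f <-> powO 0 f.
Proof.
by split=> -[C h]; exists C; apply: filterS h => t; rewrite powRr0 mulr1.
Qed.

Lemma powO_bnd e f : 0 <= e -> powO e f -> bnd f.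
Proof. by move=> e0 h; apply/bnd_powO0; exact: powO_le h. Qed.

Lemma powO_near e f g : (\forall t \near (0 : R)^'+, f t = g t) ->
  powO e f -> powO e g.
Proof. by move=> fg [C h]; exists C; apply: filterS2 fg h => t ->. Qed.

Lemma powOX e f n : powO e f -> powO (e * n%:R) (fun t => f t ^+ n).
Proof.
move=> h; elim: n => [|n IH].
  rewrite mulr0; apply/bnd_powO0.
  by under eq_fun do rewrite expr0; exact: bnd_cst.
rewrite -natr1 mulrDr mulr1 addrC.
by under eq_fun do rewrite exprS; exact: powOM.
Qed.

Lemma powO_negl e f : 1 < e -> powO e f -> negl f.
Proof.
move=> e1 [C h] d d0; have C1 : 0 < `|C| + 1 by rewrite ltr_wpDl.
have e0 : 0 < e - 1 by rewrite subr_gt0.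
apply: filterS3 near0_gt (near0_pow_le e0 (divr_gt0 d0 C1)) h => t t0 te.
move=> /le_trans; apply.
have -> : e = (e - 1) + 1 by ring.
rewrite powRD_gt0// powRr1 ?(ltW t0)// mulrA ler_wpM2r ?(ltW t0)//.
apply: (@le_trans _ _ ((`|C| + 1) * t `^ (e - 1))).
  rewrite ler_wpM2r ?powR_ge0// (le_trans (ler_norm C))// lerDl//.
by rewrite mulrC -ler_pdivlMr.
Qed.

Lemma negl_powO1 f : negl f -> powO 1 f.
Proof.
move=> h; exists 1; apply: filterS2 near0_gt (h 1 ltr01) => t t0.
by rewrite powRr1// ltW.
Qed.

Lemma powO_cvg0 e f : 0 < e -> powO e f -> f t @[t --> 0^'+] --> 0.
Proof.
move=> e0 [C h]; have C1 : 0 < `|C| + 1 by rewrite ltr_wpDl.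
apply/cvgrPdist_le => d d0.
apply: filterS2 (near0_pow_le e0 (divr_gt0 d0 C1)) h => t te.
rewrite sub0r normrN => /le_trans; apply.
apply: (@le_trans _ _ ((`|C| + 1) * t `^ e)).
  rewrite ler_wpM2r ?powR_ge0// (le_trans (ler_norm C))// lerDl//.
by rewrite mulrC -ler_pdivlMr.
Qed.

Definition peval p (t : R) := \sum_(c <- p) c.2 * t `^ c.1.

(** Unsorted lists with repeated exponents make sums and products plain list operations. The
    equality is exact for every t > 0, so it survives division by a power of t. *)
Definition gpoly x := exists2 p, all (fun c : R * R => 0 <= c.1) p &
  forall t : R, 0 < t -> x t = peval p t.

Definition gpoly0 x := exists2 p, all (fun c : R * R => 0 < c.1) p &
  forall t : R, 0 < t -> x t = peval p t.

Definition pux x := exists2 y, gpoly y & meq x y.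

Lemma gpoly0W x : gpoly0 x -> gpoly x.
Proof. by move=> [p p0 xE]; exists p => //; apply: sub_all p0 => c /ltW. Qed.

Lemma gpoly_mono b a : 0 <= a -> gpoly (fun t => b * t `^ a).
Proof.
move=> a0; exists [:: (a, b)]; first by rewrite /= a0.
by move=> t t0; rewrite /peval big_seq1.
Qed.

Lemma gpoly0_mono b a : 0 < a -> gpoly0 (fun t => b * t `^ a).
Proof.
move=> a0; exists [:: (a, b)]; first by rewrite /= a0.
by move=> t t0; rewrite /peval big_seq1.
Qed.

Lemma gpoly_cst c : gpoly (fun=> c).
Proof.
by have [p p0 pE] := gpoly_mono c (lexx 0); exists p => // t /pE <-;
  rewrite powRr0 mulr1.
Qed.

Lemma gpoly0_0 : gpoly0 (fun=> 0).
Proof. by exists [::] => // t _; rewrite /peval big_nil. Qed.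

Lemma gpolyD x y : gpoly x -> gpoly y -> gpoly (fun t => x t + y t).
Proof.
move=> [p p0 xE] [q q0 yE]; exists (p ++ q); first by rewrite all_cat p0.
by move=> t t0; rewrite /peval big_cat xE// yE.
Qed.

Lemma gpoly0D x y : gpoly0 x -> gpoly0 y -> gpoly0 (fun t => x t + y t).
Proof.
move=> [p p0 xE] [q q0 yE]; exists (p ++ q); first by rewrite all_cat p0.
by move=> t t0; rewrite /peval big_cat xE// yE.
Qed.

Lemma gpoly_ext x y : (forall t, 0 < t -> x t = y t) -> gpoly x -> gpoly y.
Proof. by move=> xy [p p0 xE]; exists p => // t t0; rewrite -xy// xE. Qed.

Lemma gpoly0_ext x y : (forall t, 0 < t -> x t = y t) -> gpoly0 x -> gpoly0 y.
Proof. by move=> xy [p p0 xE]; exists p => // t t0; rewrite -xy// xE. Qed.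

Lemma gpolyMmono x b a : 0 <= a -> gpoly x -> gpoly (fun t => b * t `^ a * x t).
Proof.
move=> a0 [p p0 xE]; exists [seq (a + c.1, b * c.2) | c <- p].
  by rewrite all_map; apply: sub_all p0 => c /= ?; rewrite addr_ge0.
move=> t t0; rewrite /peval big_map xE// /peval mulr_sumr.
by apply: eq_bigr => c _; rewrite /= powRD_gt0//; ring.
Qed.

Lemma gpoly0Mmono x b a : 0 < a -> gpoly x -> gpoly0 (fun t => b * t `^ a * x t).
Proof.
move=> a0 [p p0 xE]; exists [seq (a + c.1, b * c.2) | c <- p].
  by rewrite all_map; apply: sub_all p0 => c /= ?; rewrite ltr_wpDr.
move=> t t0; rewrite /peval big_map xE// /peval mulr_sumr.
by apply: eq_bigr => c _; rewrite /= powRD_gt0//; ring.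
Qed.

Lemma gpolyM x y : gpoly x -> gpoly y -> gpoly (fun t => x t * y t).
Proof.
move=> [p p0 xE] gy.
suff : gpoly (fun t => peval p t * y t).
  by apply: gpoly_ext => t t0; rewrite xE.
elim: p p0 {xE} => [_|c p IH /= /andP[c0 /IH {}IH]].
  by under eq_fun do rewrite /peval big_nil mul0r; exact: gpoly_cst.
apply: gpoly_ext (gpolyD (gpolyMmono c.2 c0 gy) IH) => t t0.
by rewrite /peval big_cons mulrDl.
Qed.

Lemma gpoly0M x y : gpoly0 x -> gpoly y -> gpoly0 (fun t => x t * y t).
Proof.
move=> [p p0 xE] gy.
suff : gpoly0 (fun t => peval p t * y t).
  by apply: gpoly0_ext => t t0; rewrite xE.
elim: p p0 {xE} => [_|c p IH /= /andP[c0 /IH {}IH]].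
  by under eq_fun do rewrite /peval big_nil mul0r; exact: gpoly0_0.
apply: gpoly0_ext (gpoly0D (gpoly0Mmono c.2 c0 gy) IH) => t t0.
by rewrite /peval big_cons mulrDl.
Qed.

Lemma gpolyX x n : gpoly x -> gpoly (fun t => x t ^+ n).
Proof.
move=> gx; elim: n => [|n IH].
  by under eq_fun do rewrite expr0; exact: gpoly_cst.
by under eq_fun do rewrite exprS; exact: gpolyM.
Qed.

Lemma gpoly_split x : gpoly x ->
  exists c, exists2 z, gpoly0 z & forall t, 0 < t -> x t = c + z t.
Proof.
move=> [p p0 xE].
suff [c [z gz zE]] : exists c, exists2 z, gpoly0 z &
    forall t, 0 < t -> peval p t = c + z t.
  by exists c, z => // t t0; rewrite xE// zE.
elim: p p0 {x xE} => [_|[a b] p IH /= /andP[a0 /IH [c [z gz zE]]]].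
  by exists 0, (fun=> 0) => [|t t0]; [exact: gpoly0_0|rewrite /peval big_nil addr0].
move: a0; rewrite le_eqVlt => /predU1P[<-|a0].
  exists (b + c), z => // t t0.
  by rewrite /peval big_cons/= powRr0 mulr1 -addrA -zE.
exists c, (fun t => b * t `^ a + z t); first exact: gpoly0D (gpoly0_mono _ a0) gz.
by move=> t t0; rewrite /peval big_cons/= -/(peval p t) zE//; ring.
Qed.

Lemma powO_mono b a : powO a (fun t => b * t `^ a).
Proof.
exists `|b|; near=> t.
by rewrite normrM (ger0_norm (powR_ge0 _ _)).
Unshelve. all: by end_near. Qed.

(** The exponent d is the least one occurring, capped at 1 so that an o(t) error is also O(t^d). *)
Lemma gpoly0_powO z : gpoly0 z -> exists2 d, 0 < d <= 1 & powO d z.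
Proof.
move=> [p p0 zE].
suff [d d0 h] : exists2 d, 0 < d <= 1 & powO d (peval p).
  exists d => //; apply: powO_near h.
  by apply: filterS near0_gt => t t0; rewrite zE.
elim: p p0 {z zE} => [_|[a b] p IH /= /andP[a0 /IH [d /andP[d0 d1] h]]].
  exists 1; first by rewrite ltr01 lexx.
  apply: powO_near (powO_mono 0 1); near=> t.
  by rewrite /peval big_nil mul0r.
exists (Num.min a d); first by rewrite lt_min a0 d0 ge_min d1 orbT.
have -> : peval ((a, b) :: p) = (fun t => b * t `^ a + peval p t).
  by apply/funext => t; rewrite /peval big_cons.
apply: powOD; first by apply: powO_le (powO_mono _ _); rewrite ge_min lexx.
by apply: powO_le h; rewrite ge_min lexx orbT.
Unshelve. all: by end_near. Qed.

Lemma gpoly_bnd x : gpoly x -> bnd x.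
Proof.
move=> /gpoly_split[c [z /gpoly0_powO [d /andP[d0 _] h] xE]].
apply: bnd_near (bndD (bnd_cst c) (powO_bnd (ltW d0) h)).
by apply: filterS near0_gt => t t0; rewrite xE.
Qed.

Lemma pux_bnd x : pux x -> bnd x.
Proof. by move=> [y /gpoly_bnd yb /meq_sym xy]; exact: bnd_meq yb. Qed.

Lemma pux_meq x y : meq x y -> pux x -> pux y.
Proof.
by move=> xy [z gz xz]; exists z => //; apply: meq_trans xz; exact: meq_sym.
Qed.

Lemma gpoly_pux x : gpoly x -> pux x.
Proof. by move=> gx; exists x => //; exact: meq_refl. Qed.

Lemma pux_cst c : pux (fun=> c).
Proof. exact/gpoly_pux/gpoly_cst. Qed.

Lemma puxD x y : pux x -> pux y -> pux (fun t => x t + y t).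
Proof.
move=> [x' gx xx'] [y' gy yy']; exists (fun t => x' t + y' t).
  exact: gpolyD.
exact: meqD.
Qed.

Lemma puxM x y : pux x -> pux y -> pux (fun t => x t * y t).
Proof.
move=> px py; have bx := pux_bnd px.
have [x' gx xx'] := px; have [y' gy yy'] := py.
exists (fun t => x' t * y' t); first exact: gpolyM.
by apply: meqM => //; exact: gpoly_bnd.
Qed.

Lemma puxN x : pux x -> pux (fun t => - x t).
Proof.
by move=> /(puxM (pux_cst (-1))); under eq_fun do rewrite mulN1r.
Qed.

Lemma puxB x y : pux x -> pux y -> pux (fun t => x t - y t).
Proof. by move=> px /puxN; exact: puxD. Qed.

Lemma puxX x n : pux x -> pux (fun t => x t ^+ n).
Proof.
move=> gx; elim: n => [|n IH].
  by under eq_fun do rewrite expr0; exact: pux_cst.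
by under eq_fun do rewrite exprS; exact: puxM.
Qed.

Lemma pux_sum (I : Type) (s : seq I) (P : pred I) (F : I -> R -> R) :
  (forall i, P i -> pux (F i)) -> pux (fun t => \sum_(i <- s | P i) F i t).
Proof.
move=> FG; elim: s => [|i s IH].
  by under eq_fun do rewrite big_nil; exact: pux_cst.
under eq_fun do rewrite big_cons.
by case: (boolP (P i)) => // Pi; exact: puxD (FG i Pi) IH.
Qed.

Lemma pux_limit x : pux x -> exists c, exists2 d, 0 < d <= 1 &
  powO d (fun t => x t - c).
Proof.
move=> [y /gpoly_split[c [z /gpoly0_powO [d /andP[d0 d1] h] yE]] xy].
exists c, d; first by rewrite d0.
apply: powO_near (powOD h (powO_le d1 (negl_powO1 xy))).
by apply: filterS near0_gt => t t0; rewrite yE//; ring.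
Qed.

Lemma pux_cvg x c : pux x -> x t @[t --> 0^'+] --> c ->
  exists2 d, 0 < d <= 1 & powO d (fun t => x t - c).
Proof.
move=> /pux_limit[c' [d /andP[d0 d1] h]] xc; exists d; first by rewrite d0.
suff -> : c = c' by [].
have xc' : x t @[t --> 0^'+] --> c'.
  by apply/subr_cvg0; exact: powO_cvg0 h.
exact: (cvg_unique _ xc xc').
Qed.

(** The terms of least exponent b are merged into beta. If they cancel, the remaining list is
    strictly shorter and induction on the length applies; if b > 1, the whole function is o(t). *)
Lemma gpoly_lead x : gpoly x -> negl x \/
  exists (b beta : R) (q : R -> R), [/\ 0 <= b <= 1, beta != 0, gpoly0 q &
    forall t, 0 < t -> x t = t `^ b * (beta + q t)].
Proof.
move=> [p]; have [n] := ubnP (size p); elim: n => // n IH in p x *.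
rewrite ltnS => pn p0 xE.
have [pnil|pnnil] := eqVneq p [::].
  left; apply: negl_near negl0; apply: filterS near0_gt => t t0.
  by rewrite xE// pnil /peval big_nil.
have [c0 c0p c0min] : exists2 c, c \in p & forall c', c' \in p -> c.1 <= c'.1.
  elim: p {pn p0 xE} pnnil => // c p IHp _.
  have [->|/IHp[c' c'p c'm]] := eqVneq p [::].
    by exists c; rewrite ?mem_head// => c'; rewrite inE => /eqP ->.
  have [cc'|c'c] := leP c.1 c'.1.
    exists c; first exact: mem_head.
    move=> c''; rewrite inE => /predU1P[->//|/c'm]; exact: le_trans.
  exists c'; first by rewrite inE c'p orbT.
  by move=> c''; rewrite inE => /predU1P[->|/c'm//]; exact: ltW.
set b := c0.1 in c0min.
pose beta := \sum_(c <- p | c.1 == b) c.2.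
pose r := [seq c <- p | c.1 != b].
have pE t : 0 < t -> x t = beta * t `^ b + peval r t.
  move=> t0; rewrite xE// /peval (bigID (fun c => c.1 == b))/= big_filter.
  congr (_ + _); rewrite mulr_suml; apply: eq_bigr => c /eqP -> //.
have rpos c : c \in r -> b < c.1.
  rewrite mem_filter => /andP[cb cp].
  by rewrite lt_neqAle eq_sym cb c0min.
have b0 : 0 <= b by move: p0 => /allP; apply.
have [beta0|beta0] := eqVneq beta 0.
  apply: (IH r).
    apply: leq_trans pn; have <- := count_predC (fun c : R * R => c.1 != b) p.
    rewrite size_filter -addn1 leq_add2l -has_count.
    by apply/hasP; exists c0 => //=; rewrite negbK.
  - by apply/allP => c /rpos /ltW; exact: le_trans.
  - by move=> t t0; rewrite pE// beta0 mul0r add0r.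
pose q t := peval [seq (c.1 - b, c.2) | c <- r] t.
have gq : gpoly0 q.
  exists [seq (c.1 - b, c.2) | c <- r] => //.
  by rewrite all_map; apply/allP => c /rpos /=; rewrite subr_gt0.
have xE' t : 0 < t -> x t = t `^ b * (beta + q t).
  move=> t0; rewrite pE// mulrDr mulrC; congr (_ + _).
  rewrite /q /peval big_map mulr_sumr; apply: eq_bigr => c _ /=.
  by rewrite mulrCA -powRD_gt0// subrKC.
have [b1|b1] := leP b 1.
  by right; exists b, beta, q; rewrite b0 b1.
left; apply: (powO_negl b1).
have bq : bnd (fun t => beta + q t).
  by apply: bndD; [exact: bnd_cst|exact/gpoly_bnd/gpoly0W].
have := powOM (powO_mono 1 b) ((bnd_powO0 _).1 bq); rewrite addr0.
by apply: powO_near; apply: filterS near0_gt => t t0; rewrite mul1r xE'.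
Qed.

Lemma pux_lead x : pux x -> negl x \/
  exists (b beta : R) (q : R -> R), [/\ 0 <= b <= 1, beta != 0, gpoly0 q &
    meq x (fun t => t `^ b * (beta + q t))].
Proof.
move=> [y /gpoly_lead yl xy]; case: yl => [ny|[b [beta [q [b01 h0 gq yE]]]]].
  by left; apply: negl_near (neglD xy ny); near=> t; ring.
right; exists b, beta, q; split=> //; apply: meq_trans xy _.
by apply: meq_near; apply: filterS near0_gt => t t0; rewrite yE.
Unshelve. all: by end_near. Qed.

Definition ole x y := forall e, 0 < e ->
  \forall t \near (0 : R)^'+, x t <= y t + e * t.

(** A gap linear in t is the right strict order: a series that is not o(t) has a leading exponent at
    most 1, so its absolute value eventually exceeds a positive multiple of t. *)
Definition olt x y := exists2 e, 0 < e &
  \forall t \near (0 : R)^'+, x t + e * t <= y t.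

Lemma pux_pos x : pux x -> [\/ negl x, olt (fun=> 0) x | olt x (fun=> 0)].
Proof.
move=> /pux_lead[?|[b [beta [q [/andP[b0 b1] beta0 gq xE]]]]].
  by constructor 1.
have bb : 0 < `|beta| / 4 by rewrite divr_gt0 ?normr_gt0.
have [d /andP[d0 _] [C qO]] := gpoly0_powO gq.
have C1 : 0 < `|C| + 1 by rewrite ltr_wpDl.
(* The o(t) remainder and the term t^b q each consume a quarter of |beta| t^b; since t <= t^b, a
   positive multiple of t is left over. *)
have key : \forall t \near (0 : R)^'+,
   [/\ 0 < t, `|x t - t `^ b * beta| <= t `^ b * (`|beta| / 2)
    & t <= t `^ b].
  near=> t.
  have t0 : 0 < t by near: t; exact: near0_gt.
  have tb : t <= t `^ b.
    rewrite -[leLHS](powRr1 (ltW t0)) ger_powR// t0/=.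
    by apply/ltW; near: t; exact: near0_lt.
  split=> //.
  have -> : x t - t `^ b * beta =
    (x t - t `^ b * (beta + q t)) + t `^ b * q t by ring.
  have -> : `|beta| / 2 = `|beta| / 4 + `|beta| / 4 by field.
  rewrite [leRHS]mulrDr (le_trans (ler_normD _ _))// lerD//.
    apply: (@le_trans _ _ (`|beta| / 4 * t)); first by near: t; exact: xE.
    by rewrite mulrC ler_wpM2r// ltW.
  rewrite normrM (ger0_norm (powR_ge0 _ _)) ler_wpM2l ?powR_ge0//.
  apply: (@le_trans _ _ (C * t `^ d)); first by near: t; exact: qO.
  apply: (@le_trans _ _ ((`|C| + 1) * t `^ d)).
    rewrite ler_wpM2r ?powR_ge0// (le_trans (ler_norm C))// lerDl//.
  by rewrite mulrC -ler_pdivlMr//; near: t; apply: near0_pow_le => //; exact: divr_gt0.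
have [betan|betap] := ltP beta 0.
  constructor 3; exists (`|beta| / 4) => //; apply: filterS key => t [t0 + tb].
  rewrite (ltr0_norm betan) ler_norml => /andP[_]; nra.
have {}betap : 0 < beta by rewrite lt_neqAle eq_sym beta0.
constructor 2; exists (`|beta| / 4) => //; apply: filterS key => t [t0 + tb].
rewrite (gtr0_norm betap) ler_norml => /andP[+ _]; nra.
Unshelve. all: by end_near. Qed.

Lemma pux_cmp x y : pux x -> pux y -> [\/ meq x y, olt x y | olt y x].
Proof.
move=> px py; case: (pux_pos (puxB px py)) => [h|[e e0 h]|[e e0 h]].
- by constructor 1.
- by constructor 3; exists e => //; apply: filterS h => t; rewrite add0r lerBrDr addrC.
- by constructor 2; exists e => //; apply: filterS h => t; rewrite addrAC subr_le0.
Qed.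

Lemma ole_olt x y : ole x y -> olt y x -> False.
Proof.
move=> xy [e e0 yx]; have e2 : 0 < e / 2 by rewrite divr_gt0.
have [t [t0 h1 h2]] : exists t, [/\ 0 < t, x t <= y t + e / 2 * t
    & y t + e * t <= x t].
  by apply/(@filter_ex _ (0 : R)^'+); apply: filterS3 near0_gt (xy _ e2) yx => t.
nra.
Qed.

Lemma meq_ole x y : meq x y -> ole x y.
Proof.
move=> h e /h; apply: filterS => t; rewrite ler_norml => /andP[_].
by rewrite lerBlDr addrC.
Qed.

Lemma olt_near x y : olt x y -> \forall t \near (0 : R)^'+, x t < y t.
Proof.
move=> [e e0]; apply: filterS2 near0_gt => t t0; apply: lt_le_trans.
by rewrite ltrDl mulr_gt0.
Qed.

Lemma near_ole x y : (\forall t \near (0 : R)^'+, x t <= y t) -> ole x y.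
Proof.
move=> h e e0; apply: filterS2 near0_gt h => t t0 /le_trans; apply.
by rewrite lerDl mulr_ge0// ltW.
Qed.

Lemma olt_ole x y : olt x y -> ole x y.
Proof. by move=> /olt_near h; apply: near_ole; apply: filterS h => t /ltW. Qed.

Lemma ole_trans y x z : ole x y -> ole y z -> ole x z.
Proof.
move=> xy yz e e0; have e2 : 0 < e / 2 by rewrite divr_gt0.
apply: filterS2 (xy _ e2) (yz _ e2) => t h1 h2; lra.
Qed.

Lemma ole_anti x y : ole x y -> ole y x -> meq x y.
Proof.
move=> xy yx e e0; apply: filterS2 (xy _ e0) (yx _ e0) => t h1 h2.
by rewrite ler_norml; apply/andP; split; lra.
Qed.

Lemma pux_ole_or x y : pux x -> pux y -> ole x y \/ olt y x.
Proof.
by move=> px py; case: (pux_cmp px py) => [/meq_ole|/olt_ole|]; [left|left|right].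
Qed.

End GermsAtZero.

(** * Newton iteration and monotone branches *)

Section Hensel.
Context {R : realType}.
Implicit Types (f g s z : R -> R) (F : R -> R -> R).

(** Division-free way to say that difference quotients of F between arguments of size O(t^d) are l +
    O(t^d). Recording the size t^e of the increment separately is what lets each Newton step gain a
    factor t^d. *)
Definition has_slope (d : R) F (l : R) := forall f g e,
  powO d f -> powO d g -> powO e (fun t => g t - f t) ->
  powO (e + d) (fun t => F t (g t) - F t (f t) - l * (g t - f t)).

Lemma powOZ e c f : powO e f -> powO e (fun t => c * f t).
Proof.
by move=> fO; rewrite -[e]add0r; apply: powOM => //; apply/bnd_powO0/bnd_cst.
Qed.

Lemma powON e f : powO e f -> powO e (fun t => - f t).
Proof. by move=> /(powOZ (-1)); under eq_fun do rewrite mulN1r. Qed.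

Lemma powO0 e : powO e (fun _ : R => 0).
Proof.
exists 0; near=> t; by rewrite normr0 mul0r.
Unshelve. all: by end_near. Qed.

Lemma powO_bndM e f g : powO e f -> bnd g -> powO e (fun t => g t * f t).
Proof. by move=> fO /bnd_powO0 gb; rewrite -[e]add0r; apply: powOM. Qed.

Lemma powO_powB (c d e : R) f g n : 0 < d -> powO d f -> powO d g ->
  powO e (fun t => g t - f t) ->
  powO e (fun t => (c + g t) ^+ n - (c + f t) ^+ n).
Proof.
move=> d0 fO gO fgO; elim: n => [|n IH].
  by under eq_fun do rewrite !expr0 subrr; exact: powO0.
have bf := bndX n (bndD (bnd_cst c) (powO_bnd (ltW d0) fO)).
have bg := bndD (bnd_cst c) (powO_bnd (ltW d0) gO).
apply: powO_near (powOD (powO_bndM IH bg) (powO_bndM fgO bf)).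
by near=> t; rewrite !exprS; ring.
Unshelve. all: by end_near. Qed.

Lemma has_slope_pow (d c : R) n : 0 < d ->
  has_slope d (fun _ u => (c + u) ^+ n) (n%:R * c ^+ n.-1).
Proof.
move=> d0 f g e fO gO fgO; elim: n => [|n IH].
  apply: powO_near (powO0 _); near=> t.
  by rewrite !expr0 subrr mul0r mul0r subrr.
have gD := powO_powB c n d0 fO gO fgO.
have f0 : powO d (fun t => (c + f t) ^+ n - c ^+ n).
  apply: powO_near (powO_powB c n d0 (powO0 d) fO _).
    by near=> t; rewrite addr0.
  by under eq_fun do rewrite subr0.
have bc := bnd_cst c.
(* Leibniz rule: the new remainder is c times the previous one plus two products of an O(t^e) factor
   with an O(t^d) factor. *)
have := powOD (powOD (powO_bndM IH bc) (powOM gD gO)) (powOM fgO f0).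
apply: powO_near; near=> t.
case: n {IH gD f0} => [|n].
  by rewrite !expr1 !expr0; ring.
rewrite /= !exprS -[n.+2%:R]natr1 -[n.+1%:R]natr1; ring.
Unshelve. all: by end_near. Qed.

Lemma has_slope_term (d c a0 : R) a n : 0 < d -> powO d (fun t => a t - a0) ->
  has_slope d (fun t u => a t * (c + u) ^+ n) (a0 * (n%:R * c ^+ n.-1)).
Proof.
move=> d0 aO f g e fO gO fgO.
have h1 := powO_powB c n d0 fO gO fgO.
have h2 := has_slope_pow c n d0 fO gO fgO.
apply: powO_near (powOD (powOM h1 aO) (powOZ a0 h2)); near=> t; ring.
Unshelve. all: by end_near. Qed.

Lemma has_slopeD d F1 F2 l1 l2 : has_slope d F1 l1 -> has_slope d F2 l2 ->
  has_slope d (fun t u => F1 t u + F2 t u) (l1 + l2).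
Proof.
move=> h1 h2 f g e fO gO fgO.
apply: powO_near (powOD (h1 _ _ _ fO gO fgO) (h2 _ _ _ fO gO fgO)).
near=> t; ring.
Unshelve. all: by end_near. Qed.

Lemma has_slope_cst d z : has_slope d (fun t _ => z t) 0.
Proof.
move=> f g e _ _ _; apply: powO_near (powO0 _); near=> t; ring.
Unshelve. all: by end_near. Qed.

Lemma has_slope_sum d n (F : nat -> R -> R -> R) (l : nat -> R) :
  (forall i, (i < n)%N -> has_slope d (F i) (l i)) ->
  has_slope d (fun t u => \sum_(i < n) F i t u) (\sum_(i < n) l i).
Proof.
elim: n => [_|n IH h].
  rewrite big_ord0; have := @has_slope_cst d (fun=> 0).
  move=> h f g e fO gO fgO; apply: powO_near (h f g e fO gO fgO).
  by near=> t; rewrite !big_ord0.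
have h1 := has_slopeD (IH (fun i iN => h i (ltnW iN))) (h n (ltnSn n)).
rewrite big_ord_recr/= => f g e fO gO fgO; apply: powO_near (h1 f g e fO gO fgO).
by near=> t; rewrite !big_ord_recr.
Unshelve. all: by end_near. Qed.

(* Newton's iteration with the constant slope l gains a factor t ^ d at each
   step. *)
Lemma hensel (d l : R) F : 0 < d -> l != 0 -> has_slope d F l ->
  powO d (fun t => F t 0) -> (forall s, gpoly0 s -> gpoly0 (fun t => F t (s t))) ->
  forall M, exists s, [/\ gpoly0 s & powO M (fun t => F t (s t))].
Proof.
move=> d0 l0 slF F0 Fg M.
have [k kM] : exists k : nat, M <= d * k.+1%:R.
  exists (Num.trunc (M / d)); rewrite mulrC -ler_pdivrMr//.
  by rewrite ltW// truncnS_gt.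
suff [s [gs _ sO]] : exists s, [/\ gpoly0 s, powO d s &
    powO (d * k.+1%:R) (fun t => F t (s t))].
  by exists s; split=> //; exact: powO_le sO.
elim: k {kM} => [|k [s [gs sO FO]]].
  exists (fun=> 0); split; [exact: gpoly0_0|exact: powO0|by rewrite mulr1].
pose s' t := s t + - l^-1 * F t (s t).
have dk : powO d (fun t => F t (s t)).
  by apply: powO_le FO; rewrite ler_peMr ?ler1n// ltW.
have s'O : powO d s' by apply: powOD => //; exact: powOZ.
exists s'; split=> //.
  apply: gpoly0D => //.
  have := gpoly0M (Fg _ gs) (gpoly_cst (- l^-1)).
  by apply: gpoly0_ext => t _; rewrite mulrC.
have ss' : powO (d * k.+1%:R) (fun t => s' t - s t).
  by apply: powO_near (powOZ (- l^-1) FO); near=> t; rewrite /s'; ring.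
have -> : d * k.+2%:R = d * k.+1%:R + d by rewrite -[in LHS]natr1 mulrDr mulr1.
(* By the choice of s', F(s) + l (s' - s) = 0, so the new residual is exactly the remainder bounded
   by [has_slope]. *)
apply: powO_near (slF _ _ _ sO s'O ss'); near=> t; rewrite /s'.
by field.
Unshelve. all: by end_near. Qed.

Lemma gpoly0_powB c s n : gpoly0 s ->
  gpoly0 (fun t => (c + s t) ^+ n - c ^+ n).
Proof.
move=> gs; elim: n => [|n IH].
  by apply: gpoly0_ext gpoly0_0 => t _; rewrite subrr.
have gc := gpolyD (gpoly_cst c) (gpoly0W gs).
apply: gpoly0_ext (gpoly0D (gpoly0M IH gc) (gpoly0M gs (gpoly_cst (c ^+ n)))).
by move=> t _; rewrite !exprS; ring.
Qed.

Lemma gpoly0_sum n (A : nat -> R -> R) : (forall i, (i < n)%N -> gpoly0 (A i)) ->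
  gpoly0 (fun t => \sum_(i < n) A i t).
Proof.
elim: n => [_|n IH h].
  by apply: gpoly0_ext gpoly0_0 => t _; rewrite big_ord0.
apply: gpoly0_ext (gpoly0D (IH (fun i iN => h i (ltnW iN))) (h n (ltnSn n))).
by move=> t _; rewrite big_ord_recr.
Qed.

Lemma powO_common n (A : nat -> R -> R) :
  (forall i, exists2 d, 0 < d <= 1 & powO d (A i)) ->
  exists2 d, 0 < d <= 1 & forall i, (i < n)%N -> powO d (A i).
Proof.
move=> h; elim: n => [|n [d /andP[d0 d1] dA]]; first by exists 1; rewrite ?ltr01/=.
have [d' /andP[d'0 d'1] d'A] := h n.
exists (Num.min d d'); first by rewrite lt_min d0 d'0 ge_min d1.
move=> i; rewrite ltnS leq_eqVlt => /predU1P[->|/dA].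
  by apply: powO_le d'A; rewrite ge_min lexx orbT.
by apply: powO_le; rewrite ge_min lexx.
Qed.

Definition psum (m n : nat) (p : nat -> R -> R) (t u : R) :=
  \sum_(i < n.+1) p i t * u ^+ (m + i).

Lemma psum_meq m n p q f : bnd f -> (forall i, pux (p i)) ->
  (forall i, meq (p i) (q i)) ->
  meq (fun t => psum m n p t (f t)) (fun t => psum m n q t (f t)).
Proof.
move=> bf pp pq; apply: meq_sum => i _; apply: meqM => //.
- exact: pux_bnd.
- exact: bndX.
- exact: meq_refl.
Qed.

Lemma cvg_lim_eq f (a b : R) : f t @[t --> 0^'+] --> a ->
  f t @[t --> 0^'+] --> b -> a = b.
Proof. by move=> fa fb; exact: (cvg_unique _ fa fb). Qed.

(* The substitution u = t ^ (b / m) (c + s), with l c ^ m = beta, turns the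
   equation into one with a simple root at s = 0. *)
Lemma psum_solve m n p z (l b beta : R) q : (0 < m)%N ->
  (forall i, pux (p i)) -> p 0%N t @[t --> 0^'+] --> l -> 0 < l ->
  0 < b -> 0 < beta -> gpoly0 q -> meq z (fun t => t `^ b * (beta + q t)) ->
  exists s, [/\ gpoly0 s, \forall t \near (0 : R)^'+, 0 < s t &
    meq (fun t => psum m n p t (s t)) z].
Proof.
move=> m0 pp pl l0 b0 beta0 gq zE.
(* Division by t^b would magnify the o(t) errors in the p_i, so the equation is rescaled with exact
   representatives P_i. *)
have [P PP] : exists P : nat -> R -> R, forall i, gpoly (P i) /\ meq (p i) (P i).
  suff /boolp.choice[P] : forall i, exists y, gpoly y /\ meq (p i) y by exists P.
  by move=> i; have [y] := pp i; exists y.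
have gP i : gpoly (P i) := (PP i).1.
have pP i : meq (p i) (P i) := (PP i).2.
have [l' [P0 gP0 P0E]] := gpoly_split (gP 0%N).
have l'E : l' = l.
  apply: (@cvg_lim_eq (p 0%N)) pl.
  have [d /andP[d0 d1] P0O] := gpoly0_powO gP0.
  apply/subr_cvg0; apply: (powO_cvg0 d0).
  apply: powO_near (powOD P0O (powO_le d1 (negl_powO1 (pP 0%N)))).
  by apply: filterS near0_gt => t t0; rewrite P0E//; ring.
rewrite {l'}l'E in P0E.
pose c := (beta / l) `^ (m%:R^-1).
have mn0 : m%:R != 0 :> R by rewrite pnatr_eq0 -lt0n.
have c0 : 0 < c by rewrite powR_gt0// divr_gt0.
have cm : l * c ^+ m = beta.
  rewrite -powR_mulrn ?(ltW c0)// -powRrM mulVf// powRr1 ?divr_ge0 ?ltW//.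
  by rewrite mulrC divfK// gt_eqF.
(* At u = t^k (c + s) the i-th term of [psum] carries t^b t^(k i). After division by t^b, only the
   term i = 0 keeps a nonzero limiting coefficient, namely l. *)
pose k := b / m%:R.
have k0 : 0 < k by rewrite divr_gt0// ltr0n.
pose a i t := P i t * t `^ (k * i%:R).
have ga i : gpoly (a i).
  have : gpoly (fun t => 1 * t `^ (k * i%:R) * P i t).
    by apply: gpolyMmono => //; rewrite mulr_ge0// ltW.
  by apply: gpoly_ext => t _; rewrite /a mul1r mulrC.
pose a0 i := if i is 0%N then l else 0.
have ga0 i : gpoly0 (fun t => a i t - a0 i).
  case: i => [|i].
    apply: gpoly0_ext gP0 => t t0.
    by rewrite /a/= mulr0 powRr0 mulr1 P0E//; ring.
  have : gpoly0 (fun t => 1 * t `^ (k * i.+1%:R) * P i.+1 t).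
    by apply: gpoly0Mmono => //; rewrite mulr_gt0.
  by apply: gpoly0_ext => t _; rewrite /a/= mul1r mulrC subr0.
have [d /andP[d0 d1] aO] := @powO_common n.+1 _ (fun i => gpoly0_powO (ga0 i)).
pose F t u := \sum_(i < n.+1) a i t * (c + u) ^+ (m + i) - (beta + q t).
have Fg s : gpoly0 s -> gpoly0 (fun t => F t (s t)).
  move=> gs.
  have h i : (i < n.+1)%N ->
      gpoly0 (fun t => a i t * (c + s t) ^+ (m + i) - a0 i * c ^+ (m + i)).
    move=> _; have gc := gpolyD (gpoly_cst c) (gpoly0W gs).
    have := gpoly0D (gpoly0M (ga0 i) (gpolyX (m + i) gc))
      (gpoly0M (gpoly0_powB c (m + i) gs) (gpoly_cst (a0 i))).
    by apply: gpoly0_ext => t _; ring.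
  have := gpoly0D (gpoly0_sum h) (gpoly0M gq (gpoly_cst (-1))).
  apply: gpoly0_ext => t _; rewrite sumrB.
  rewrite [X in _ - X + _]big_ord_recl/= addn0 cm [X in beta + X]big1 ?addr0.
    by rewrite /F; ring.
  by move=> i _; rewrite mul0r.
have [d' /andP[d'0 d'1] F0] := gpoly0_powO (Fg _ gpoly0_0).
pose e := Num.min d d'.
have e0 : 0 < e by rewrite lt_min d0 d'0.
have ed : e <= d by rewrite ge_min lexx.
have ed' : e <= d' by rewrite ge_min lexx orbT.
have slF : has_slope e F (l * (m%:R * c ^+ m.-1)).
  have h i : (i < n.+1)%N -> has_slope e
      (fun t u => a i t * (c + u) ^+ (m + i))
      (a0 i * ((m + i)%:R * c ^+ (m + i).-1)).
    by move=> iN; apply: has_slope_term => //; exact: powO_le (aO i iN).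
  have := has_slopeD (has_slope_sum h) (@has_slope_cst e (fun t => - (beta + q t))).
  rewrite addr0 [X in has_slope _ _ X]big_ord_recl/= addn0 big1 ?addr0//.
  by move=> i _; rewrite mul0r.
have l1 : l * (m%:R * c ^+ m.-1) != 0.
  by rewrite !mulf_neq0// ?expf_neq0 ?gt_eqF.
(* Order 2 exceeds 1, so the residual is o(t) and remains so after multiplication by the bounded
   factor t^b. *)
have [s [gs sO]] := hensel e0 l1 slF (powO_le ed' F0) Fg 2.
have gS : gpoly0 (fun t => t `^ k * (c + s t)).
  have := gpoly0Mmono 1 k0 (gpolyD (gpoly_cst c) (gpoly0W gs)).
  by apply: gpoly0_ext => t _; rewrite mul1r.
exists (fun t => t `^ k * (c + s t)); split=> //.
  have [d1' /andP[d1'0 _] /(powO_cvg0 d1'0)/cvgrPdist_lt/(_ c c0)] := gpoly0_powO gs.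
  apply: filterS2 near0_gt => t t0; rewrite sub0r normrN ltr_norml => /andP[h _].
  by rewrite mulr_gt0 ?powR_gt0//; lra.
apply: meq_trans (psum_meq m n (gpoly_bnd (gpoly0W gS)) pp pP) _.
apply: meq_trans (meq_sym zE).
have : negl (fun t => F t (s t) * t `^ b).
  apply: neglM; first by apply: powO_negl sO; rewrite ltr1n.
  have /gpoly_bnd := gpoly_mono 1 (ltW b0).
  by under eq_fun do rewrite mul1r.
apply: negl_near; apply: filterS near0_gt => t t0.
suff -> : psum m n P t (t `^ k * (c + s t)) =
    t `^ b * \sum_(i < n.+1) a i t * (c + s t) ^+ (m + i) by rewrite /F; ring.
rewrite /psum mulr_sumr; apply: eq_bigr => i _; rewrite /a.
rewrite exprMn -(powR_mulrn _ (powR_ge0 t k)) -powRrM natrD mulrDr powRD_gt0//.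
rewrite divfK//; ring.
Unshelve. all: by end_near. Qed.

End Hensel.

(** * Monotonicity and intermediate values for polynomials of lowest degree m *)

Section PolynomialIVP.
Context {R : realType}.
Implicit Types (s z : R -> R) (p : nat -> R -> R).

(** The difference splits into w (w^(k+1) - u^(k+1)) and u (u^k w - u^(k+1)), each at most r times
    the increment of degree k+1. On a short interval, the increments of higher powers are thus
    absorbed by that of the lowest one. *)
Lemma lerB_powS (k : nat) (u w r : R) : 0 <= u -> u <= w -> w <= r ->
  w ^+ k.+2 - u ^+ k.+2 <= 2 * r * (w ^+ k.+1 - u ^+ k.+1).
Proof.
move=> u0 uw wr.
have w0 := le_trans u0 uw; have r0 := le_trans w0 wr.
have uk : 0 <= u ^+ k by rewrite exprn_ge0.
have ukw : u ^+ k * w <= w ^+ k.+1.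
  by rewrite exprSr ler_wpM2r// lerXn2r.
have h1 : u ^+ k.+1 <= w ^+ k.+1 by rewrite lerXn2r.
have -> : w ^+ k.+2 - u ^+ k.+2 =
   w * (w ^+ k.+1 - u ^+ k.+1) + u * (u ^+ k * w - u ^+ k.+1).
  by rewrite !exprS; ring.
have : w * (w ^+ k.+1 - u ^+ k.+1) <= r * (w ^+ k.+1 - u ^+ k.+1).
  by rewrite ler_wpM2r// subr_ge0.
have : u * (u ^+ k * w - u ^+ k.+1) <= r * (w ^+ k.+1 - u ^+ k.+1).
  rewrite ler_pM// ?lerD2r//; last exact: le_trans wr.
  by rewrite subr_ge0 exprSr ler_wpM2l.
lra.
Qed.

Lemma lerB_pow (m i : nat) (u w r : R) : (0 < m)%N -> 0 <= u -> u <= w ->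
  w <= r -> 2 * r <= 1 ->
  w ^+ (m + i.+1) - u ^+ (m + i.+1) <= 2 * r * (w ^+ m - u ^+ m).
Proof.
case: m => // m _ u0 uw wr r1; elim: i => [|i IH].
  by rewrite addn1; exact: lerB_powS.
rewrite addnS; apply: le_trans (lerB_powS (m + i.+1) u0 uw wr) _.
have r0 : 0 <= r by apply: le_trans wr; exact: le_trans uw.
apply: le_trans IH; rewrite -[leRHS]mul1r ler_wpM2r//.
by rewrite subr_ge0 lerXn2r// nnegrE//; exact: le_trans uw.
Qed.

Lemma bnd_common n (A : nat -> R -> R) : (forall i, bnd (A i)) ->
  exists2 K : R, 0 < K & \forall t \near (0 : R)^'+,
    forall i, (i < n)%N -> `|A i t| <= K.
Proof.
move=> h; elim: n => [|n [K K0 IH]]; first by exists 1 => //; near=> t.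
have [C hC] := h n; exists (Num.max K C); first by rewrite lt_max K0.
apply: filterS2 IH hC => t IH hC i.
by rewrite ltnS leq_eqVlt le_max => /predU1P[->|/IH ->//]; rewrite hC orbT.
Unshelve. all: by end_near. Qed.

Lemma psum_incr m n p (l : R) : (0 < m)%N -> (forall i, bnd (p i)) ->
  p 0%N t @[t --> 0^'+] --> l -> 0 < l ->
  exists2 r, 0 < r & \forall t \near (0 : R)^'+,
    forall u w, 0 <= u -> u <= w -> w <= r -> psum m n p t u <= psum m n p t w.
Proof.
move=> m0 pb pl l0; have [K K0 hK] := bnd_common n.+1 pb.
have l2 : 0 < l / 2 by rewrite divr_gt0.
have nK : 0 < n.+1%:R * K by rewrite mulr_gt0.
(* The bound 1/2 is what [lerB_pow] requires; the other makes the n higher terms, with coefficients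
   at most K, consume at most half of the growth l of the leading term. *)
pose r := Num.min (2^-1) (l / 2 / 2 / (n.+1%:R * K)).
have r0 : 0 < r by rewrite lt_min invr_gt0 ltr0n/= !divr_gt0.
have r2 : 2 * r <= 1 by rewrite -ler_pdivlMl// mulr1 ge_min lexx.
have rK : 2 * r * (n.+1%:R * K) <= l / 2.
  have : r <= l / 2 / 2 / (n.+1%:R * K) by rewrite ge_min lexx orbT.
  rewrite ler_pdivlMr//; lra.
exists r => //.
apply: filterS2 hK ((cvgrPdist_le _ _).1 pl _ l2) => t hK pt u w u0 uw wr.
have p0t : l / 2 <= p 0%N t by move: pt; rewrite ler_norml => /andP[_]; lra.
rewrite -subr_ge0 /psum -sumrB big_ord_recl/= addn0 -mulrBr.
set D := w ^+ m - u ^+ m.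
have D0 : 0 <= D by rewrite subr_ge0 lerXn2r// nnegrE//; exact: le_trans uw.
have h : `|\sum_(i < n) (p i.+1 t * w ^+ (m + i.+1) - p i.+1 t * u ^+ (m + i.+1))|
    <= l / 2 * D.
  apply: (@le_trans _ _ (\sum_(i < n) K * (2 * r * D))).
    apply: le_trans (ler_norm_sum _ _ _) _; apply: ler_sum => i _.
    rewrite -mulrBr normrM ler_pM//; first by apply: hK; rewrite ltnS.
    rewrite ger0_norm; first exact: lerB_pow.
    by rewrite subr_ge0 lerXn2r// nnegrE//; exact: le_trans uw.
  rewrite sumr_const card_ord -[leLHS]mulr_natl.
  apply: (@le_trans _ _ (2 * r * (n.+1%:R * K) * D)); last by rewrite ler_wpM2r.
  have : 0 <= K * (2 * r * D) by rewrite !mulr_ge0// ltW.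
  rewrite -(natr1 n); lra.
have : l / 2 * D <= p 0%N t * D by rewrite ler_wpM2r.
by move: h; rewrite ler_norml => /andP[+ _]; lra.
Qed.

Lemma psum_pux m n p s : (forall i, pux (p i)) -> pux s ->
  pux (fun t => psum m n p t (s t)).
Proof. by move=> pp ps; apply: pux_sum => i _; apply: puxM => //; exact: puxX. Qed.

Lemma psum_powO m n p s d : (0 < m)%N -> 0 <= d -> (forall i, bnd (p i)) ->
  powO d s -> powO d (fun t => psum m n p t (s t)).
Proof.
move=> m0 d0 pb sO.
suff h k : powO d (fun t => \sum_(i < k) p i t * s t ^+ (m + i)) by exact: h.
elim: k => [|k IH].
  by apply: powO_near (powO0 d); near=> t; rewrite big_ord0.
have := powOD IH (powO_bndM (powO_bndM sO (bndX (m.-1 + k) (powO_bnd d0 sO))) (pb k)).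
apply: powO_near; near=> t; rewrite big_ord_recr/=; congr (_ + _ * _).
by rewrite -exprSr -addSn prednK.
Unshelve. all: by end_near. Qed.

(** A bound at which z is attained modulo o(t) is itself the root. Otherwise both inequalities are
    strict, and a root strictly outside the bounds would contradict one of them by monotonicity. *)
Lemma psum_ivp m n p z s1 s2 (l d : R) : (0 < m)%N ->
  (forall i, pux (p i)) -> p 0%N t @[t --> 0^'+] --> l -> 0 < l ->
  pux z -> pux s1 -> pux s2 -> 0 < d -> powO d s2 ->
  (\forall t \near (0 : R)^'+, 0 <= s1 t <= s2 t) ->
  ole (fun t => psum m n p t (s1 t)) z -> ole z (fun t => psum m n p t (s2 t)) ->
  exists s, [/\ pux s, \forall t \near (0 : R)^'+, 0 <= s t, ole s1 s, ole s s2 &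
    meq (fun t => psum m n p t (s t)) z].
Proof.
move=> m0 pp pl l0 pz ps1 ps2 d0 s2O s12 G1 G2.
have pG s : pux s -> pux (fun t => psum m n p t (s t)) by exact: psum_pux.
have [r r0 incr] := psum_incr n m0 (fun i => pux_bnd (pp i)) pl l0.
have s2r : \forall t \near (0 : R)^'+, s2 t <= r.
  have /cvgrPdist_le/(_ r r0) := powO_cvg0 d0 s2O.
  by apply: filterS => t; rewrite sub0r normrN => /(le_trans (ler_norm _)).
case: (pux_cmp (pG _ ps1) pz) => [E1|L1|/(ole_olt G1)//].
  exists s1; split=> //.
  - by apply: filterS s12 => t /andP[].
  - by apply: near_ole; near=> t.
  - by apply: near_ole; apply: filterS s12 => t /andP[].
case: (pux_cmp pz (pG _ ps2)) => [E2|L2|/(ole_olt G2)//].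
  exists s2; split=> //.
  - by apply: filterS s12 => t /andP[]; exact: le_trans.
  - by apply: near_ole; apply: filterS s12 => t /andP[].
  - by apply: near_ole; near=> t.
  - exact: meq_sym.
(* Since m > 0, the sum vanishes at 0, so z > 0 by monotonicity; z also tends to 0, being below the
   value at s2. Its leading term then has positive exponent and positive coefficient, as
   [psum_solve] requires. *)
have [e e0 L1e] := L1.
have L0 : olt (fun=> 0) z.
  exists e => //.
  apply: filterS (filterI L1e (filterI s12 (filterI incr s2r))).
  move=> t [Gz [/andP[s10 s1s2] [inc s2t]]]; apply: le_trans Gz.
  rewrite lerD2r; have := inc _ _ (lexx 0) s10 (le_trans s1s2 s2t).
  apply: le_trans; rewrite /psum sumr_ge0// => i _.
  by rewrite expr0n addn_eq0 (gtn_eqF m0) mulr0.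
have z0 := olt_near L0.
have zcvg : z t @[t --> 0^'+] --> 0.
  apply: (@squeeze_cvgr _ _ _ _ (fun=> 0) (fun t => psum m n p t (s2 t))).
  - by apply: filterS2 z0 (olt_near L2) => t /ltW -> /ltW ->.
  - exact: cvg_cst.
  - by apply: (powO_cvg0 d0); apply: psum_powO => //;
      [exact: ltW|move=> i; exact: pux_bnd].
have zle : ~ ole z (fun=> 0) by move=> /ole_olt; apply.
case: (pux_lead pz) => [nz|[b [beta [q [/andP[b0 b1] beta0 gq zE]]]]].
  by case: zle; apply: meq_ole; apply: negl_near nz; near=> t; rewrite subr0.
have [dq /andP[dq0 _] qO] := gpoly0_powO gq.
have b_gt0 : 0 < b.
  rewrite lt_neqAle b0 andbT; apply/eqP => bE; move/eqP: beta0; apply.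
  apply: (@cvg_lim_eq R z _ _ _ zcvg); apply/subr_cvg0.
  have h0 : 0 < Num.min 1 dq by rewrite lt_min ltr01.
  apply: (powO_cvg0 h0).
  have h1 : powO (Num.min 1 dq) q by apply: powO_le qO; rewrite ge_min lexx orbT.
  have h2 : powO (Num.min 1 dq) (fun t => z t - t `^ b * (beta + q t)).
    by apply: powO_le (negl_powO1 zE); rewrite ge_min lexx.
  apply: powO_near (powOD h1 h2); near=> t.
  by rewrite -bE powRr0; ring.
have beta_gt0 : 0 < beta.
  rewrite lt_neqAle eq_sym beta0 leNgt; apply/negP => beta_lt0; apply: zle.
  apply: ole_trans (meq_ole zE) _; apply: near_ole.
  have beta1 : 0 < - beta by rewrite oppr_gt0.
  have /cvgrPdist_le/(_ _ beta1) := powO_cvg0 dq0 qO.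
  apply: filterS => t; rewrite sub0r normrN ler_norml => /andP[_ h].
  by rewrite mulr_ge0_le0 ?powR_ge0//; lra.
have [s [gs s_gt0 sE]] := psum_solve n m0 pp pl l0 b_gt0 beta_gt0 gq zE.
have ps := gpoly_pux (gpoly0W gs).
have sr : \forall t \near (0 : R)^'+, s t <= r.
  have [ds /andP[ds0 _] sO] := gpoly0_powO gs.
  have /cvgrPdist_le/(_ r r0) := powO_cvg0 ds0 sO.
  by apply: filterS => t; rewrite sub0r normrN => /(le_trans (ler_norm _)).
exists s; split=> //.
- by apply: filterS s_gt0 => t /ltW.
- case: (pux_ole_or ps1 ps) => // /olt_near ss1; exfalso.
  apply: (ole_olt _ L1); apply: ole_trans (meq_ole (meq_sym sE)) _.
  apply: near_ole; near=> t.
  have /andP[s10 s1s2] : 0 <= s1 t <= s2 t by near: t.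
  have inc : forall u w, 0 <= u -> u <= w -> w <= r ->
    psum m n p t u <= psum m n p t w by near: t.
  apply: inc; first by apply/ltW; near: t.
    by apply/ltW; near: t.
  by apply: (le_trans s1s2); near: t.
- case: (pux_ole_or ps ps2) => // /olt_near s2s; exfalso.
  apply: (ole_olt _ L2); apply: ole_trans _ (meq_ole sE).
  apply: near_ole; near=> t.
  have /andP[s10 s1s2] : 0 <= s1 t <= s2 t by near: t.
  have inc : forall u w, 0 <= u -> u <= w -> w <= r ->
    psum m n p t u <= psum m n p t w by near: t.
  apply: inc; first exact: le_trans s1s2.
    by apply/ltW; near: t.
  by near: t.
Unshelve. all: by end_near. Qed.

End PolynomialIVP.

(** * The intermediate value property in a monad *)

Section LocalIVP.
Context {R : realType}.
Implicit Types (F : R -> R -> R) (s y z : R -> R) (p : nat -> R -> R).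

(** The coefficients p do not depend on the truncation order n, and the remainder is uniform in u: n
    can be fixed later, once the size t^d of the displacement is known. The error e absorbs the
    negligible coefficients of degree below m. *)
Record expansion F (r : R) (m : nat) p (l : R) : Prop := Expansion {
  exp_order : (0 < m)%N;
  exp_pux : forall i, pux (p i);
  exp_lim : p 0%N t @[t --> 0^'+] --> l;
  exp_neq0 : l != 0;
  exp_val : pux (fun t => F t r);
  exp_approx : forall n, exists C rho e, [/\ 0 < rho, negl e &
    \forall t \near (0 : R)^'+, forall u, `|u| <= rho ->
      `|F t (r + u) - F t r - psum m n p t u| <= C * `|u| ^+ (m + n.+1) + e t] }.

Lemma psumN m n p t u : psum m n (fun i t => - p i t) t u = - psum m n p t u.
Proof. by rewrite /psum -sumrN; apply: eq_bigr => i _; rewrite mulNr. Qed.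

Lemma psum_opp m n p t u :
  psum m n (fun i t => (-1) ^+ (m + i) * p i t) t u = psum m n p t (- u).
Proof. by apply: eq_bigr => i _; rewrite [in RHS]exprNn; ring. Qed.

Lemma expansion_neg F r m p l : expansion F r m p l ->
  expansion (fun t x => - F t x) r m (fun i t => - p i t) (- l).
Proof.
move=> [m0 pp pl l0 pF approx]; split=> //.
- by move=> i; exact: puxN.
- exact: cvgN.
- by rewrite oppr_eq0.
- exact: puxN.
move=> n; have [C [rho [e [rho0 ne H]]]] := approx n.
exists C, rho, e; split=> //; apply: filterS H => t H u /H.
by rewrite psumN -normrN; congr (`|_| <= _); ring.
Qed.

(** Reflection turns displacements to the left of r into displacements to the right; together with
    [expansion_neg] it leaves only one case to be treated by hand. *)
Lemma expansion_opp F r m p l : expansion F r m p l ->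
  expansion (fun t x => F t (- x)) (- r) m
    (fun i t => (-1) ^+ (m + i) * p i t) ((-1) ^+ m * l).
Proof.
move=> [m0 pp pl l0 pF approx]; split=> //.
- by move=> i; apply: puxM => //; exact: pux_cst.
- by rewrite addn0; apply: cvgMr.
- by rewrite mulf_neq0// signr_eq0.
- by rewrite opprK.
move=> n; have [C [rho [e [rho0 ne H]]]] := approx n.
exists C, rho, e; split=> //; apply: filterS H => t H u.
rewrite psum_opp opprD !opprK -(normrN u); exact: H.
Qed.

(** With n about 1/d one has d (m + n + 1) > 1, so the remainder is o(t) for all displacements
    O(t^d) at once. *)
Lemma expansion_meq F r m p l d : expansion F r m p l -> 0 < d ->
  exists n, forall s, powO d s ->
    meq (fun t => F t (r + s t)) (fun t => F t r + psum m n p t (s t)).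
Proof.
move=> [m0 pp pl l0 pF approx] d0.
pose n := Num.trunc d^-1; exists n => s sO.
have dn : 1 < d * (m + n.+1)%:R.
  rewrite -ltr_pdivrMl// mulr1; apply: lt_le_trans (truncnS_gt _) _.
  by rewrite ler_nat leq_addl.
have [C [rho [e [rho0 ne H]]]] := approx n.
have h1 : negl (fun t => C * `|s t ^+ (m + n.+1)|).
  apply: (powO_negl dn); apply: powOZ.
  have [K hK] := powOX (m + n.+1) sO; exists K; apply: filterS hK => t.
  by rewrite normr_id.
apply: (negl_le _ (neglD h1 ne)); near=> t.
rewrite opprD addrA; apply: le_trans (ler_norm _); rewrite normrX.
suff h : `|s t| <= rho.
  by move: (s t) h; near: t.
near: t; have /cvgrPdist_le/(_ _ rho0) := powO_cvg0 d0 sO.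
by apply: filterS => t; rewrite sub0r normrN.
Unshelve. all: by end_near. Qed.

Lemma expansion_pux F r m p l d s : expansion F r m p l -> 0 < d ->
  pux s -> powO d s -> pux (fun t => F t (r + s t)).
Proof.
move=> ex d0 ps sO; have [n /(_ _ sO)/meq_sym h] := expansion_meq ex d0.
by apply: (pux_meq h); apply: puxD (exp_val ex) (psum_pux _ _ (exp_pux ex) ps).
Qed.

Lemma psum_meqr m n p s1 s2 : (forall i, bnd (p i)) -> bnd s1 -> meq s1 s2 ->
  meq (fun t => psum m n p t (s1 t)) (fun t => psum m n p t (s2 t)).
Proof.
move=> pb b1 s12; apply: meq_sum => i _; apply: meqM => //.
- by apply: bndX; exact: bnd_meq b1.
- exact: meq_refl.
- exact: meqX.
Qed.

Lemma expansion_congr F r m p l d s1 s2 : expansion F r m p l -> 0 < d ->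
  powO d s1 -> powO d s2 -> meq s1 s2 ->
  meq (fun t => F t (r + s1 t)) (fun t => F t (r + s2 t)).
Proof.
move=> ex d0 s1O s2O s12; have [n H] := expansion_meq ex d0.
apply: meq_trans (H _ s1O) _; apply: meq_trans (meq_sym (H _ s2O)).
apply: meqD; first exact: meq_refl.
by apply: psum_meqr (powO_bnd (ltW d0) s1O) s12 => i; exact/pux_bnd/(exp_pux ex).
Qed.

Definition between f g y := (@ole R f y /\ ole y g) \/ (ole g y /\ ole y f).

Lemma between_meq f f' g g' y : meq f f' -> meq g g' -> between f g y ->
  between f' g' y.
Proof.
move=> ff' gg' [[fy yg]|[gy yf]]; [left|right]; split.
- exact: ole_trans (meq_ole (meq_sym ff')) fy.
- exact: ole_trans yg (meq_ole gg').
- exact: ole_trans (meq_ole (meq_sym gg')) gy.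
- exact: ole_trans yf (meq_ole ff').
Qed.

Lemma oleN f g : @ole R f g -> ole (fun t => - g t) (fun t => - f t).
Proof. by move=> h e /h; apply: filterS => t; lra. Qed.

Lemma oleD2 f1 g1 f2 g2 : @ole R f1 g1 -> ole f2 g2 ->
  ole (fun t => f1 t + f2 t) (fun t => g1 t + g2 t).
Proof.
move=> h1 h2 e e0; have e2 : 0 < e / 2 by rewrite divr_gt0.
by apply: filterS2 (h1 _ e2) (h2 _ e2) => t; lra.
Qed.

Lemma ole_refl f : @ole R f f. Proof. by apply: near_ole; near=> t.
Unshelve. all: by end_near. Qed.

Lemma betweenN f g y : between f g y ->
  between (fun t => - f t) (fun t => - g t) (fun t => - y t).
Proof. by move=> [[fy yg]|[gy yf]]; [right|left]; split; exact: oleN. Qed.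

Lemma local_ivp_pos F r m p l d s1 s2 y : expansion F r m p l -> 0 < l ->
  0 < d <= 1 -> pux s1 -> pux s2 -> pux y -> powO d s2 ->
  (\forall t \near (0 : R)^'+, 0 <= s1 t <= s2 t) ->
  between (fun t => F t (r + s1 t)) (fun t => F t (r + s2 t)) y ->
  exists s, [/\ pux s, powO d s, ole s1 s, ole s s2 &
    meq (fun t => F t (r + s t)) y].
Proof.
move=> ex l0 /andP[d0 d1] ps1 ps2 py s2O s12 bt.
have [n H] := expansion_meq ex d0.
have s1O : powO d s1.
  have [C h] := s2O; exists C; apply: filterS2 s12 h => t /andP[h1 h2].
  by apply: le_trans; rewrite !ger0_norm//; exact: le_trans h2.
have pb i := pux_bnd (exp_pux ex i).
have [rho rho0 incr] := psum_incr n (exp_order ex) pb (exp_lim ex) l0.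
have s2rho : \forall t \near (0 : R)^'+, s2 t <= rho.
  have /cvgrPdist_le/(_ _ rho0) := powO_cvg0 d0 s2O.
  by apply: filterS => t; rewrite sub0r normrN => /(le_trans (ler_norm _)).
have G12 : ole (fun t => psum m n p t (s1 t)) (fun t => psum m n p t (s2 t)).
  apply: near_ole; apply: filterS (filterI s12 (filterI s2rho incr)).
  by move=> t [/andP[s10 s1s2] [s2t inc]]; exact: inc.
(* Monotonicity orders the two end values, so even when y is given between them in the reverse
   order, the direct inequalities follow. *)
have {bt} [F1 F2] : ole (fun t => F t r + psum m n p t (s1 t)) y /\
    ole y (fun t => F t r + psum m n p t (s2 t)).
  have := between_meq (H _ s1O) (H _ s2O) bt.
  have FG := oleD2 (ole_refl (fun t => F t r)) G12.
  case=> -[h1 h2]; split=> //.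
  - exact: ole_trans FG h1.
  - exact: ole_trans h2 FG.
have nF := ole_refl (fun t => - F t r).
pose z t := y t - F t r.
have z1 : ole (fun t => psum m n p t (s1 t)) z.
  apply: ole_trans _ (oleD2 F1 nF); apply/meq_ole/meq_near; near=> t; ring.
have z2 : ole z (fun t => psum m n p t (s2 t)).
  apply: (ole_trans (oleD2 F2 nF)); apply/meq_ole/meq_near; near=> t; ring.
have [s [ps s0 s1s ss2 sE]] := psum_ivp (exp_order ex) (exp_pux ex) (exp_lim ex)
  l0 (puxB py (exp_val ex)) ps1 ps2 d0 s2O s12 z1 z2.
(* From s <= s2 modulo o(t) one gets 0 <= s <= s2 + t eventually, and t is O(t^d) because d <= 1. *)
have sO : powO d s.
  have [C h] := powOD s2O (powO_le d1 (powO_mono 1 1)).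
  exists C; apply: filterS (filterI near0_gt (filterI s0 (filterI h (ss2 1 ltr01)))).
  move=> t [t0 [st [+ h2]]]; apply: le_trans.
  rewrite ger0_norm// powRr1 ?(ltW t0)//; apply: le_trans h2 (ler_norm _).
exists s; split=> //.
apply: meq_trans (H _ sO) _.
have := meqD (meq_refl (fun t => F t r)) sE; move=> /meq_trans; apply.
by apply: meq_near; near=> t; ring.
Unshelve. all: by end_near. Qed.

Lemma local_ivp_ge0 F r m p l d s1 s2 y : expansion F r m p l ->
  0 < d <= 1 -> pux s1 -> pux s2 -> pux y -> powO d s2 ->
  (\forall t \near (0 : R)^'+, 0 <= s1 t <= s2 t) ->
  between (fun t => F t (r + s1 t)) (fun t => F t (r + s2 t)) y ->
  exists s, [/\ pux s, powO d s, ole s1 s, ole s s2 &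
    meq (fun t => F t (r + s t)) y].
Proof.
move=> ex d01 ps1 ps2 py s2O s12 bt.
have [l0|l0|l0] := ltgtP 0 l; last by move: (exp_neq0 ex); rewrite -l0 eqxx.
  exact: (local_ivp_pos ex l0 d01 ps1 ps2 py s2O s12 bt).
have nl0 : 0 < - l by rewrite oppr_gt0.
have [s [ps sO s1s ss2 sE]] := local_ivp_pos (expansion_neg ex) nl0 d01 ps1 ps2
  (puxN py) s2O s12 (betweenN bt).
exists s; split=> //; have := meqN sE.
by under eq_fun do rewrite opprK; under [X in meq _ X]eq_fun do rewrite opprK.
Qed.

Lemma local_ivp_le0 F r m p l d s1 s2 y : expansion F r m p l ->
  0 < d <= 1 -> pux s1 -> pux s2 -> pux y -> powO d s1 ->
  (\forall t \near (0 : R)^'+, s1 t <= s2 t <= 0) ->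
  between (fun t => F t (r + s1 t)) (fun t => F t (r + s2 t)) y ->
  exists s, [/\ pux s, powO d s, ole s1 s, ole s s2 &
    meq (fun t => F t (r + s t)) y].
Proof.
move=> ex d01 ps1 ps2 py s1O s12 bt.
have e s : (fun t => F t (- (- r + - s t))) = (fun t => F t (r + s t)).
  by apply/funext => t; congr (F _ _); ring.
have [||s [ps sO s1s ss2 sE]] := local_ivp_ge0 (y := y) (expansion_opp ex) d01
    (puxN ps2) (puxN ps1) py (powON s1O).
- by apply: filterS s12 => t /andP[h1 h2]; apply/andP; split; lra.
- by rewrite !e; case: bt; [right|left].
exists (fun t => - s t); split=> //.
- exact: puxN.
- exact: powON.
- by have := oleN ss2; under eq_fun do rewrite opprK.
- have := oleN s1s; rewrite /ole; move=> h ep /h; apply: filterS => t.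
  by rewrite opprK.
- have := sE; apply: negl_near; near=> t; congr (F _ _ - _); ring.
Unshelve. all: by end_near. Qed.

(** The one-sided lemmas ask for pointwise signs; a negligible displacement, whose sign may
    oscillate, is replaced by 0. *)
Lemma pux_sign s d : 0 < d -> pux s -> powO d s ->
  exists s', [/\ pux s', powO d s', meq s s' &
  (\forall t \near (0 : R)^'+, 0 <= s' t) \/ (\forall t \near (0 : R)^'+, s' t <= 0)].
Proof.
move=> d0 ps sO; case: (pux_pos ps) => [ns|s0|s0].
- exists (fun=> 0); split; [exact: pux_cst|exact: powO0| |by left; near=> t].
  by apply: negl_near ns; near=> t; rewrite subr0.
- exists s; split=> //; first exact: meq_refl.
  by left; apply: filterS (olt_near s0) => t /ltW.
- exists s; split=> //; first exact: meq_refl.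
  by right; apply: filterS (olt_near s0) => t /ltW.
Unshelve. all: by end_near. Qed.

Lemma local_ivp F r m p l d s1 s2 y : expansion F r m p l ->
  0 < d <= 1 -> pux s1 -> pux s2 -> pux y -> powO d s1 -> powO d s2 ->
  ole s1 s2 ->
  between (fun t => F t (r + s1 t)) (fun t => F t (r + s2 t)) y ->
  exists s, [/\ pux s, powO d s, ole s1 s, ole s s2 &
    meq (fun t => F t (r + s t)) y].
Proof.
move=> ex d01 ps1 ps2 py s1O s2O s12 bt; have /andP[d0 d1] := d01.
have [s1' [ps1' s1'O s11' sg1]] := pux_sign d0 ps1 s1O.
have [s2' [ps2' s2'O s22' sg2]] := pux_sign d0 ps2 s2O.
have {}bt := between_meq (expansion_congr ex d0 s1O s1'O s11')
  (expansion_congr ex d0 s2O s2'O s22') bt.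
suff [s [ps sO s1s ss2 sE]] : exists s, [/\ pux s, powO d s, ole s1' s, ole s s2' &
    meq (fun t => F t (r + s t)) y].
  exists s; split=> //.
  - exact: ole_trans (meq_ole s11') s1s.
  - exact: ole_trans ss2 (meq_ole (meq_sym s22')).
have {}s12 : ole s1' s2'.
  apply: ole_trans (meq_ole (meq_sym s11')) _.
  exact: ole_trans s12 (meq_ole s22').
(* If the bounds agree modulo o(t), so do the two end values, and y is squeezed between them. *)
case: (pux_cmp ps1' ps2') => [E|/olt_near L|/(ole_olt s12)//].
  exists s1'; split=> //; [exact: ole_refl|].
  have E12 := expansion_congr ex d0 s1'O s2'O E.
  case: bt => -[h1 h2]; apply: ole_anti => //.
  - exact: ole_trans h2 (meq_ole (meq_sym E12)).
  - exact: ole_trans (meq_ole E12) h1.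
case: sg1 => [s10|s10].
  apply: (local_ivp_ge0 ex d01 ps1' ps2' py s2'O _ bt).
  by apply: filterS2 s10 L => t -> /ltW ->.
case: sg2 => [s20|s20]; last first.
  apply: (local_ivp_le0 ex d01 ps1' ps2' py s1'O _ bt).
  by apply: filterS2 s20 L => t -> /ltW ->.
have p0 := pux_cst (0 : R); have O0 := powO0 d.
have pF0 := expansion_pux ex d0 p0 O0.
have h0 : ole s1' (fun=> 0) by exact: near_ole.
have h2 : ole (fun=> 0) s2' by exact: near_ole.
(* The bounds straddle 0: the position of y relative to F t r tells on which side it is taken,
   whatever the parity of m. *)
have [b1|b2] : between (fun t => F t (r + s1' t)) (fun t => F t (r + 0)) y \/
    between (fun t => F t (r + 0)) (fun t => F t (r + s2' t)) y.
  by case: (pux_ole_or py pF0) => [|/olt_ole] h; case: bt => -[b1 b2];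
    [left; left|right; right|right; left|left; right].
- have [|s [ps sO s1s ss0 sE]] := local_ivp_le0 ex d01 ps1' p0 py s1'O _ b1.
    by apply: filterS s10 => t ->/=.
  by exists s; split=> //; exact: ole_trans h2.
- have [|s [ps sO s1s ss0 sE]] := local_ivp_ge0 ex d01 p0 ps2' py s2'O _ b2.
    by apply: filterS s20 => t ->; rewrite lexx.
  by exists s; split=> //; exact: ole_trans s1s.
Unshelve. all: by end_near. Qed.

End LocalIVP.

(** * From monads to intervals *)

Section SignChange.
Context {R : realType}.
Implicit Types (f : R -> R) (A B r rho x : R).

Lemma continuous_gt0 f r : {for r, continuous f} -> 0 < f r ->
  exists2 rho, 0 < rho & forall x, `|x - r| < rho -> 0 < f x.
Proof.
move=> fc f0; have /nbhs_ballP[rho /= rho0 H] : \forall x \near r, 0 < f x.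
  exact: (cvgr_gt _ fc).
by exists rho => // x xr; apply: H; rewrite /ball/= distrC.
Qed.

(* At the supremum of the points with f < 0, f changes sign from - to +, unless
   this supremum is an end point. *)
Lemma sign_change f A B (rpos lneg : R -> Prop) : A < B -> f A <= 0 -> 0 <= f B ->
  (forall r, A <= r <= B -> {for r, continuous f}) ->
  (forall r, A <= r < B -> f r = 0 -> rpos r \/
     exists2 rho, 0 < rho & forall x, r < x < r + rho -> x <= B -> f x < 0) ->
  (forall r, A < r <= B -> f r = 0 -> lneg r \/
     exists2 rho, 0 < rho & forall x, r - rho < x < r -> A <= x -> 0 < f x) ->
  [\/ f A = 0 /\ rpos A, f B = 0 /\ lneg B |
      exists r, [/\ A < r < B, f r = 0, rpos r & lneg r]].
Proof.
move=> AB fA fB fc fright fleft.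
pose S := [set x | A <= x <= B /\ f x < 0].
(* A zero with f >= 0 on its right excludes the second alternative of [fright]. *)
have right_ge0_rpos r : A <= r < B -> f r = 0 ->
    (forall x, r < x <= B -> 0 <= f x) -> rpos r.
  move=> rAB fr0 fge0; have [//|[rho rho0 H]] := fright r rAB fr0.
  have /andP[_ rB] := rAB.
  pose x := Num.min B (r + rho / 2).
  have rx : r < x by rewrite lt_min rB/= ltrDl divr_gt0.
  have xB : x <= B by rewrite ge_min lexx.
  have xrho : x < r + rho.
    by rewrite gt_min ltrD2l gtr_pMr// invf_lt1// ltr1n orbT.
  have := fge0 x; rewrite rx xB => /(_ isT).
  by rewrite leNgt H// rx.
have [S0|/set0P S0] := eqVneq S set0.
  have fge0 x : A <= x <= B -> 0 <= f x.
    move=> xAB; rewrite leNgt; apply/negP => fx.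
    by have : S x by []; rewrite S0.
  have fA0 : f A = 0 by apply/eqP; rewrite eq_le fA fge0// lexx ltW.
  constructor 1; split=> //; apply: right_ge0_rpos => //; first by rewrite lexx.
  by move=> x /andP[/ltW Ax xB]; rewrite fge0// Ax.
have Sub : has_sup S by split=> //; exists B => x [/andP[]].
pose r := sup S.
have Ar : A <= r.
  have [x Sx] := S0; apply: (le_trans _ (sup_upper_bound Sub Sx)).
  by case: Sx => /andP[].
have rB : r <= B by apply: ge_sup => // x [/andP[]].
have fge0 x : r < x <= B -> 0 <= f x.
  move=> /andP[rx xB]; rewrite leNgt; apply/negP => fx.
  have : x <= r by apply: sup_upper_bound => //; rewrite /S/= xB (le_trans Ar (ltW rx)).
  by rewrite leNgt rx.
have rAB : A <= r <= B by rewrite Ar.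
(* A negative value at r would persist to the right, where f >= 0; a positive one would persist to
   the left, where points of S accumulate. *)
have fr0 : f r = 0.
  have [fr|fr|//] := ltgtP (f r) 0.
    have {}rB : r < B.
      by rewrite lt_neqAle rB andbT; apply: contraTneq fB => <-; rewrite -ltNge.
    have [|//|rho rho0 H] := @continuous_gt0 (fun x => - f x) r.
      by apply: continuousN; exact: fc.
      by rewrite oppr_gt0.
    pose x := Num.min B (r + rho / 2).
    have rx : r < x by rewrite lt_min rB/= ltrDl divr_gt0.
    have xB : x <= B by rewrite ge_min lexx.
    have xrho : x < r + rho.
      by rewrite gt_min ltrD2l gtr_pMr// invf_lt1// ltr1n orbT.
    have := H x; rewrite gtr0_norm ?subr_gt0// ltrBlDl => /(_ xrho).
    by rewrite oppr_gt0 ltNge fge0// rx.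
  have [rho rho0 H] := continuous_gt0 (fc r rAB) fr.
  have [x Sx xr] := sup_adherent rho0 Sub.
  have xler : x <= r by exact: sup_upper_bound.
  have := H x; rewrite ler0_norm ?subr_le0// opprB.
  rewrite ltrBlDr -ltrBlDl ltrBlDl addrC -ltrBlDr => /(_ xr).
  by case: Sx => _ /ltW; rewrite leNgt => /negP.
have left_near rho : 0 < rho -> exists x, [/\ r - rho < x < r, A <= x & f x < 0].
  move=> rho0; have [x Sx xr] := sup_adherent rho0 Sub.
  exists x; case: (Sx) => /andP[Ax _] fx; split=> //.
  rewrite xr lt_neqAle sup_upper_bound// andbT; apply: contraTneq fx => ->.
  by rewrite -/r fr0 ltxx.
have {}Ar : A < r.
  by have [x [/andP[_ xr] Ax _]] := left_near 1 ltr01; exact: le_lt_trans xr.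
(* Points with f < 0 accumulate at r from the left, which excludes the second alternative of
   [fleft]. *)
have lr : lneg r.
  have rAB' : A < r <= B by rewrite Ar.
  have [//|[rho rho0 H]] := fleft r rAB' fr0.
  have [x [xr Ax]] := left_near rho rho0.
  by rewrite ltNge ltW// H.
move: rB; rewrite le_eqVlt => /predU1P[rB|rB].
  by constructor 2; rewrite -rB.
constructor 3; exists r; split=> //; first by rewrite Ar.
by apply: right_ge0_rpos => //; rewrite ltW.
Qed.

End SignChange.

(** * End points with different standard parts *)

Section GlobalIVP.
Context {R : realType}.
Implicit Types (F : R -> R -> R) (s y z : R -> R) (p : nat -> R -> R).

(** Truncating at n = 0 and letting t tend to 0 gives h (r + u) - h r = l u^m + O(u^(m+1)), whose
    sign for small u > 0 is that of l. *)
Lemma expansion_sign F r m p l (h : R -> R) (U : set R) : expansion F r m p l ->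
  (forall x, U x -> F t x @[t --> 0^'+] --> h x) -> U r ->
  exists2 rho, 0 < rho & forall x, r < x < r + rho -> U x -> 0 < (h x - h r) * l.
Proof.
move=> ex Fh Ur; have [C [rho [e [rho0 ne H]]]] := exp_approx ex 0.
have l0 : 0 < `|l| by rewrite normr_gt0 (exp_neq0 ex).
have C1 : 0 < `|C| + 1 by rewrite ltr_wpDl.
exists (Num.min rho (`|l| / (`|C| + 1))); first by rewrite lt_min rho0 divr_gt0.
move=> x /andP[rx]; rewrite -ltrBlDl lt_min => /andP[xrho xl] Ux.
pose u := x - r; have u0 : 0 < u by rewrite subr_gt0.
have : `|h x - h r - l * u ^+ m| <= C * `|u| ^+ m.+1 + 0.
  have e0 : e t @[t --> 0^'+] --> 0 := powO_cvg0 ltr01 (negl_powO1 ne).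
  have c1 : (C * `|u| ^+ m.+1 + e t) @[t --> 0^'+] --> C * `|u| ^+ m.+1 + 0.
    by apply: cvgD => //; exact: cvg_cst.
  have c2 : `|F t x - F t r - p 0%N t * u ^+ m| @[t --> 0^'+] -->
      `|h x - h r - l * u ^+ m|.
    apply: cvg_norm; apply: cvgB; first by apply: cvgB; exact: Fh.
    by apply: cvgMl; exact: exp_lim ex.
  apply: ler_cvg_to c2 c1 _; apply: filterS H => t /(_ u).
  rewrite /psum big_ord_recl big_ord0 addr0 addn0 addn1 /u subrKC; apply.
  by rewrite gtr0_norm// ltW.
rewrite addr0 (gtr0_norm u0) exprS mulrA => hu.
have um : 0 < u ^+ m by rewrite exprn_gt0.
have {hu} : `|h x - h r - l * u ^+ m| < `|l| * u ^+ m.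
  apply: le_lt_trans hu _; rewrite ltr_pM2r//.
  apply: (@le_lt_trans _ _ ((`|C| + 1) * u)).
    by rewrite ler_wpM2r ?(ltW u0)// (le_trans (ler_norm C))// lerDl.
  by rewrite mulrC -ltr_pdivlMr.
have [lp|lp|lE] := ltgtP l 0; last by rewrite lE normr0 ltxx in l0.
  by rewrite (ltr0_norm lp) ltr_norml => /andP[_ h1]; rewrite nmulr_lgt0//; nra.
by rewrite (gtr0_norm lp) ltr_norml => /andP[h1 _]; rewrite pmulr_lgt0//; nra.
Qed.

Lemma expansion_sign_left F r m p l (h : R -> R) (U : set R) :
  expansion F r m p l ->
  (forall x, U x -> F t x @[t --> 0^'+] --> h x) -> U r ->
  exists2 rho, 0 < rho &
    forall x, r - rho < x < r -> U x -> 0 < (h x - h r) * ((-1) ^+ m * l).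
Proof.
move=> /expansion_opp ex Fh Ur.
have Fh' x : U (- x) -> F t (- x) @[t --> 0^'+] --> h (- x) by exact: Fh.
have Ur' : U (- - r) by rewrite opprK.
have [rho rho0 H] := @expansion_sign _ _ _ _ _ (fun x => h (- x))
    [set x | U (- x)] ex Fh' Ur'.
exists rho => // x /andP[x1 x2] Ux.
have := H (- x); rewrite /= !opprK; apply => //.
by apply/andP; split; lra.
Qed.

Lemma expansion_cvg F r m p l d s (c : R) : expansion F r m p l -> 0 < d -> powO d s ->
  F t r @[t --> 0^'+] --> c ->
  (fun t => F t (r + s t)) @ (0 : R)^'+ --> c.
Proof.
move=> ex d0 sO Fc; have [n H] := expansion_meq ex d0.
have e0 := powO_cvg0 ltr01 (negl_powO1 (H _ sO)).
have e1 := powO_cvg0 d0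
  (psum_powO n (exp_order ex) (ltW d0) (fun i => pux_bnd (exp_pux ex i)) sO).
rewrite (_ : (fun t => F t (r + s t)) = (fun t => F t r + psum m n p t (s t) +
    (F t (r + s t) - (F t r + psum m n p t (s t))))).
  by have := cvgD (cvgD Fc e1) e0; rewrite !addr0; apply.
by apply/funext => t /=; ring.
Qed.

(* A displacement t ^ d with d small enough dominates y - F r. *)
Lemma expansion_upper F r m p l y (c d' : R) s' : expansion F r m p l -> 0 < l ->
  0 < d' -> powO d' s' ->
  pux y -> y t @[t --> 0^'+] --> c -> F t r @[t --> 0^'+] --> c ->
  exists s, [/\ pux s, exists2 d, 0 < d <= 1 & powO d s,
    ole s' s & ole y (fun t => F t (r + s t))].
Proof.
move=> ex l0 d'0 s'O py yc Fc.
have [dy /andP[dy0 dy1] yO] := pux_cvg py yc.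
have [dF /andP[dF0 dF1] FO] := pux_cvg (exp_val ex) Fc.
pose e := Num.min d' (Num.min dy dF).
have e0 : 0 < e by rewrite !lt_min d'0 dy0.
have e1 : e <= 1 by rewrite !ge_min dy1 orbT.
have ed' : e <= d' by rewrite ge_min lexx.
have zO : powO e (fun t => y t - F t r).
  have h1 : powO e (fun t => y t - c) by apply: powO_le yO; rewrite !ge_min lexx !orbT.
  have h2 : powO e (fun t => F t r - c).
    by apply: powO_le FO; rewrite !ge_min lexx !orbT.
  by apply: powO_near (powOD h1 (powON h2)); near=> t; ring.
have m0 := exp_order ex.
have m1 : 0 < m.+1%:R :> R by rewrite ltr0n.
(* For this d, (t^d)^m dominates t^e = (t^d)^(m+1), which bounds y - F t r; and d < e <= d' makes
   t^d dominate s'. *)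
pose d := e / m.+1%:R; have d0 : 0 < d by rewrite divr_gt0.
have d1 : d <= 1 by rewrite ler_pdivrMr// mul1r (le_trans e1)// ler1n.
pose s (t : R) := t `^ d.
have ps : pux s.
  by have /gpoly_pux := gpoly_mono 1 (ltW d0); under eq_fun do rewrite mul1r.
have sO : powO d s by have := powO_mono 1 d; under eq_fun do rewrite mul1r.
exists s; split=> //; first by exists d; rewrite ?d0.
  have dd' : 0 < d' - d.
    rewrite subr_gt0; apply: lt_le_trans ed'.
    by rewrite ltr_pdivrMr// ltr_pMr// ltr1n.
  have [C hC] := s'O; have C1 : 0 < `|C| + 1 by rewrite ltr_wpDl.
  apply: near_ole; near=> t; apply: (le_trans (ler_norm _)).
  have t0 : 0 < t by near: t; exact: near0_gt.
  apply: (@le_trans _ _ (C * t `^ d')); first by near: t.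
  apply: (@le_trans _ _ ((`|C| + 1) * t `^ d')).
    by rewrite ler_wpM2r ?powR_ge0// (le_trans (ler_norm C))// lerDl.
  rewrite -(subrK d d') powRD_gt0// mulrA ler_piMl ?powR_ge0//.
  rewrite mulrC -ler_pdivlMr//; near: t; apply: near0_pow_le => //.
have [n H] := expansion_meq ex d0.
apply: ole_trans _ (meq_ole (meq_sym (H _ sO))).
apply: near_ole.
have pb i := pux_bnd (exp_pux ex i).
(* Factoring out the lowest power gives psum = s^m (p_0 + w), with w tending to 0. *)
pose w t := \sum_(i < n) p i.+1 t * s t ^+ (1 + i).
have wO : powO d w.
  rewrite /w; clear -pb sO d0; case: n => [|n].
    by apply: powO_near (powO0 d); near=> t; rewrite big_ord0.
  exact: (@psum_powO _ 1 n (fun i => p i.+1) s d isT (ltW d0) (fun i => pb i.+1) sO).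
have l2 : 0 < l / 2 by rewrite divr_gt0.
have l4 : 0 < l / 2 / 2 by rewrite divr_gt0.
have [C hC] := zO.
have C1 : 0 < `|C| + 1 by rewrite ltr_wpDl.
near=> t.
have t0 : 0 < t by near: t; exact: near0_gt.
have st0 : 0 < s t by rewrite powR_gt0.
(* Eventually y - F t r <= (|C| + 1) s^(m+1) <= (l/2) s^m, whereas p_0 + w >= l - l/4 - l/4. *)
have stC : (`|C| + 1) * s t <= l / 2.
  rewrite mulrC -ler_pdivlMr//; near: t; apply: near0_pow_le => //.
  by rewrite divr_gt0.
have wt : `|w t| <= l / 2 / 2.
  near: t; have /cvgrPdist_le/(_ _ l4) := powO_cvg0 d0 wO.
  by apply: filterS => t; rewrite sub0r normrN.
have pt : `|l - p 0%N t| <= l / 2 / 2.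
  by near: t; exact: (cvgrPdist_le _ _).1 (exp_lim ex) _ l4.
have yt : y t - F t r <= (`|C| + 1) * s t ^+ m.+1.
  have -> : s t ^+ m.+1 = t `^ e.
    by rewrite -powR_mulrn ?powR_ge0// -powRrM divfK// gt_eqF.
  apply: le_trans (ler_norm _) _; apply: (@le_trans _ _ (C * t `^ e)).
    by near: t.
  by rewrite ler_wpM2r ?powR_ge0// (le_trans (ler_norm C))// lerDl.
have -> : psum m n p t (s t) = s t ^+ m * (p 0%N t + w t).
  rewrite /psum /w big_ord_recl/= addn0 mulrDr mulrC mulr_sumr; congr (_ + _).
  by apply: eq_bigr => i _; rewrite mulrCA -exprD.
rewrite addrC -lerBlDr; apply: (le_trans yt).
rewrite exprSr mulrCA ler_wpM2l ?exprn_ge0 ?(ltW st0)//.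
move: wt pt; rewrite !ler_norml => /andP[w1 _] /andP[_ p1]; lra.
Unshelve. all: by end_near. Qed.

(** For u >= 0 the leading coefficient of F t (r - u) is (-1)^m l; reflecting x and negating F turns
    a negative one into the positive coefficient of [expansion_upper]. *)
Lemma expansion_lower F r m p l y (c d' : R) s' :
  expansion F r m p l -> (-1) ^+ m * l < 0 -> 0 < d' -> powO d' s' ->
  pux y -> y t @[t --> 0^'+] --> c -> F t r @[t --> 0^'+] --> c ->
  exists s, [/\ pux s, exists2 d, 0 < d <= 1 & powO d s,
    ole s s' & ole (fun t => F t (r + s t)) y].
Proof.
move=> ex l0 d'0 s'O py yc Fc.
have ex' := expansion_neg (expansion_opp ex).
have l0' : 0 < - ((-1) ^+ m * l) by rewrite oppr_gt0.
have Fc' : - F t (- - r) @[t --> 0^'+] --> - c by rewrite opprK; exact: cvgN.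
have [s [ps [d d01 sO] s0 ys]] := expansion_upper ex' l0' d'0 (powON s'O)
  (puxN py) (cvgN yc) Fc'.
exists (fun t => - s t); split; [exact: puxN|by exists d => //; exact: powON| |].
  have := oleN s0; rewrite /ole; move=> h e /h; apply: filterS => t.
  by rewrite opprK.
have := oleN ys; move=> h e /h; apply: filterS => t.
by rewrite !opprK opprD opprK.
Qed.

Lemma cvg_ole (f g : R -> R) (a b : R) :
  f t @[t --> 0^'+] --> a -> g t @[t --> 0^'+] --> b ->
  ole f g -> a <= b.
Proof.
move=> fa gb fg.
have t0 : t @[t --> (0 : R)^'+] --> (0 : R) by exact/cvg_at_right_filter/cvg_id.
have gb' : (fun t => g t + 1 * t) @ (0 : R)^'+ --> b.
  rewrite (_ : (fun t => g t + 1 * t) = g \+ id); last first.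
    by apply/funext => t /=; rewrite mul1r.
  by rewrite -[b]addr0; exact: cvgD.
by apply: ler_cvg_to fa gb' _; exact: fg.
Qed.

Lemma cvg_lt_ole (f g : R -> R) (a b : R) :
  f t @[t --> 0^'+] --> a -> g t @[t --> 0^'+] --> b ->
  a < b -> ole f g.
Proof.
move=> fa gb ab; have ab2 : a < (a + b) / 2 < b by apply/andP; split; lra.
have /andP[h1 h2] := ab2; apply: near_ole; near=> t.
apply: (@le_trans _ _ ((a + b) / 2)); apply/ltW; near: t.
  exact: (cvgr_lt _ fa).
exact: (cvgr_gt _ gb).
Unshelve. all: by end_near. Qed.

Lemma cvg_shift s (r d : R) : 0 < d -> powO d s -> (fun t => r + s t) @ (0 : R)^'+ --> r.
Proof.
move=> d0 /(powO_cvg0 d0) h.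
by have := cvgD (cvg_cst r) h; rewrite addr0; apply.
Qed.

Lemma is_intervalW (U : set R) A B x : is_interval U -> U A -> U B -> A <= x <= B ->
  U x.
Proof. by move=> iU UA UB; exact: iU. Qed.

Section Global.
Variables (U : set R) (h : R -> R).
Hypothesis iU : is_interval U.

Definition expandable F := [/\ forall r, U r -> exists m p l, expansion F r m p l,
  forall r, U r -> F t r @[t --> 0^'+] --> h r &
  forall r, U r -> {for r, continuous h}].

Lemma global_ivp F a b y A B : expandable F ->
  pux a -> a t @[t --> 0^'+] --> A -> U A ->
  pux b -> b t @[t --> 0^'+] --> B -> U B -> ole a b ->
  pux y -> ole (fun t => F t (a t)) y -> ole y (fun t => F t (b t)) ->
  exists c C, [/\ pux c, c t @[t --> 0^'+] --> C, U C & [/\ ole a c, ole c b &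
    meq (fun t => F t (c t)) y]].
Proof.
move=> [exE Fh hc] pa aA UA pb bB UB ab py ay yb.
have [da /andP[da0 da1] aO] := pux_cvg pa aA.
have [db /andP[db0 db1] bO] := pux_cvg pb bB.
have AB := cvg_ole aA bB ab.
have psa : pux (fun t => a t - A) := puxB pa (pux_cst A).
have psb : pux (fun t => b t - B) := puxB pb (pux_cst B).
have Ea : (fun t => F t (A + (a t - A))) = (fun t => F t (a t)).
  by apply/funext => t; rewrite subrKC.
have Eb : (fun t => F t (B + (b t - B))) = (fun t => F t (b t)).
  by apply/funext => t; rewrite subrKC.
have loc r s1 s2 d1 d2 : U r -> 0 < d1 <= 1 -> 0 < d2 <= 1 -> pux s1 -> pux s2 ->
    powO d1 s1 -> powO d2 s2 -> ole s1 s2 ->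
    ole (fun t => F t (r + s1 t)) y -> ole y (fun t => F t (r + s2 t)) ->
    exists c, [/\ pux c, c t @[t --> 0^'+] --> r, ole (fun t => r + s1 t) c,
      ole c (fun t => r + s2 t) & meq (fun t => F t (c t)) y].
  move=> Ur /andP[d10 d11] /andP[d20 d21] ps1 ps2 s1O s2O s12 ys1 ys2.
  pose d := Num.min d1 d2.
  have d0 : 0 < d by rewrite lt_min d10.
  have d01 : 0 < d <= 1 by rewrite d0 ge_min d11.
  have s1O' : powO d s1 by apply: powO_le s1O; rewrite ge_min lexx.
  have s2O' : powO d s2 by apply: powO_le s2O; rewrite ge_min lexx orbT.
  have [m [p [l ex]]] := exE _ Ur.
  have [|s [ps sO s1s ss2 sE]] := local_ivp ex d01 ps1 ps2 py s1O' s2O' s12.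
    by left.
  exists (fun t => r + s t); split=> //.
  - exact: puxD (pux_cst r) ps.
  - exact: cvg_shift sO.
  - by apply: oleD2 => //; exact: ole_refl.
  - by apply: oleD2 => //; exact: ole_refl.
move: AB; rewrite le_eqVlt => /predU1P[AB|AB].
  subst B.
  have sab : ole (fun t => a t - A) (fun t => b t - A).
    by apply: oleD2 => //; exact: ole_refl.
  rewrite -Ea in ay; rewrite -Eb in yb.
  have da01 : 0 < da <= 1 by rewrite da0.
  have db01 : 0 < db <= 1 by rewrite db0.
  have [c] := loc A _ _ da db UA da01 db01 psa psb aO bO sab ay yb.
  rewrite (_ : (fun t => A + (a t - A)) = a); last by apply/funext => t; rewrite subrKC.
  rewrite (_ : (fun t => A + (b t - A)) = b); last by apply/funext => t; rewrite subrKC.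
  by move=> [pc cA ac cb cE]; exists c, A.
have [Y [dY /andP[dY0 _] yO]] := pux_limit py.
have yY : y t @[t --> 0^'+] --> Y by apply/subr_cvg0; exact: powO_cvg0 yO.
have FA : (fun t => F t (a t)) @ (0 : R)^'+ --> h A.
  have [m [p [l ex]]] := exE _ UA; rewrite -Ea.
  exact: expansion_cvg ex da0 aO (Fh _ UA).
have FB : (fun t => F t (b t)) @ (0 : R)^'+ --> h B.
  have [m [p [l ex]]] := exE _ UB; rewrite -Eb.
  exact: expansion_cvg ex db0 bO (Fh _ UB).
have UAB r : A <= r <= B -> U r by exact: is_intervalW.
(* These are the predicates fed to [sign_change]. The bound s' is arbitrary so that it can be a - A
   or b - B at an end point and 0 at an interior point. *)
pose right_up r := forall d' s', 0 < d' -> powO d' s' ->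
  exists s, [/\ pux s, exists2 d, 0 < d <= 1 & powO d s,
    ole s' s & ole y (fun t => F t (r + s t))].
pose left_down r := forall d' s', 0 < d' -> powO d' s' ->
  exists s, [/\ pux s, exists2 d, 0 < d <= 1 & powO d s,
    ole s s' & ole (fun t => F t (r + s t)) y].
have : [\/ h A - Y = 0 /\ right_up A, h B - Y = 0 /\ left_down B |
    exists r, [/\ A < r < B, h r - Y = 0, right_up r & left_down r]].
  apply: (sign_change (f := fun x => h x - Y)) => //.
  - by rewrite subr_le0; exact: cvg_ole ay.
  - by rewrite subr_ge0; exact: cvg_ole yb.
  - move=> r /UAB Ur; apply: continuousB; first exact: hc.
    exact: cst_continuous.
  (* At a zero of h - Y, l > 0 makes F rise above y within the monad to the right of r, while l < 0
     makes h itself smaller than Y just to the right. *)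
  - move=> r /andP[Ar rB] /eqP; rewrite subr_eq0 => /eqP hr.
    have Ur : U r by apply: UAB; rewrite Ar ltW.
    have [m [p [l ex]]] := exE _ Ur.
    have Fr : F t r @[t --> 0^'+] --> Y by rewrite -hr; exact: Fh.
    have [l0|l0|l0] := ltgtP 0 l; last by move: (exp_neq0 ex); rewrite -l0 eqxx.
      by left=> d' s' d'0 s'O; exact: expansion_upper ex l0 d'0 s'O py yY Fr.
    right; have [rho rho0 H] := expansion_sign ex Fh Ur.
    exists rho => // x xr xB; have Ux : U x.
      by apply: UAB; rewrite xB andbT; case/andP: (xr) => rx _; exact: le_trans (ltW rx).
    by have := H x xr Ux; rewrite hr nmulr_lgt0.
  (* The same dichotomy on the left, governed by the sign of (-1)^m l. *)
  - move=> r /andP[Ar rB] /eqP; rewrite subr_eq0 => /eqP hr.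
    have Ur : U r by apply: UAB; rewrite rB ltW.
    have [m [p [l ex]]] := exE _ Ur.
    have Fr : F t r @[t --> 0^'+] --> Y by rewrite -hr; exact: Fh.
    have [l0|l0|l0] := ltgtP ((-1) ^+ m * l) 0; last first.
    - by move: (exp_neq0 ex) => /eqP[]; move/eqP: l0; rewrite mulf_eq0 signr_eq0 => /eqP.
    - right; have [rho rho0 H] := expansion_sign_left ex Fh Ur.
      exists rho => // x xr Ax; have Ux : U x.
        apply: UAB; rewrite Ax/=; case/andP: (xr) => _ rx.
        exact: (le_trans (ltW rx)).
      by have := H x xr Ux; rewrite hr pmulr_lgt0.
    - by left=> d' s' d'0 s'O; exact: expansion_lower ex l0 d'0 s'O py yY Fr.
(* At A the lower bound is a itself; the root has standard part A < B, which already places it below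
   b. The case of B is symmetric, and an interior r uses a bound from each side. *)
case=> [[_ /(_ _ _ da0 aO) [s [ps [d d01 sO] sab ys]]]||].
- have da01 : 0 < da <= 1 by rewrite da0.
  rewrite -Ea in ay.
  have [c [pc cA ac _ cE]] := loc A _ s da d UA da01 d01 psa ps aO sO sab ay ys.
  exists c, A; split=> //; split=> //; last exact: cvg_lt_ole cA bB AB.
  by apply: ole_trans ac; apply/meq_ole/meq_near; near=> t; rewrite subrKC.
- move=> [_ /(_ _ _ db0 bO) [s [ps [d d01 sO] sab ys]]].
  have db01 : 0 < db <= 1 by rewrite db0.
  rewrite -Eb in yb.
  have [c [pc cB _ cb cE]] := loc B s _ d db UB d01 db01 ps psb sO bO sab ys yb.
  exists c, B; split=> //; split=> //; first exact: cvg_lt_ole aA cB AB.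
  by apply: (ole_trans cb); apply/meq_ole/meq_near; near=> t; rewrite subrKC.
- move=> [r [/andP[Ar rB] hr up down]].
  have [s2 [ps2 [d2 d21 s2O] s20 ys2]] := up 1 _ ltr01 (powO0 1).
  have [s1 [ps1 [d1 d11 s1O] s10 ys1]] := down 1 _ ltr01 (powO0 1).
  have Ur : U r by apply: UAB; rewrite !ltW.
  have [c [pc cr _ _ cE]] := loc r s1 s2 d1 d2 Ur d11 d21 ps1 ps2 s1O s2O
    (ole_trans s10 s20) ys1 ys2.
  exists c, r; split=> //; split=> //.
  + exact: cvg_lt_ole aA cr Ar.
  + exact: cvg_lt_ole cr bB rB.
Unshelve. all: by end_near. Qed.

End Global.
End GlobalIVP.

(** * Taylor expansion along a curve *)

Section Taylor1.
Context {R : realType}.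
Implicit Types (f : nat -> R -> R).

Definition taylor_poly f N : {poly R} := \poly_(j < N) (f j 0 / j`!%:R).

Lemma deriv_taylor_poly f N :
  (taylor_poly f N.+1)^`() = taylor_poly (fun j => f j.+1) N.
Proof.
apply/polyP => i; rewrite coef_deriv !coef_poly ltnS; case: ltnP => _; last first.
  by rewrite mul0rn.
have i0 : i.+1%:R != 0 :> R by rewrite pnatr_eq0.
have j0 : i`!%:R != 0 :> R by rewrite pnatr_eq0 -lt0n fact_gt0.
by rewrite factS natrM -[LHS]mulr_natr [i.+1%:R * _]mulrC invfM mulrA mulfVK.
Qed.

(** Here f j plays the role of the j-th derivative. The derivative of a remainder is the remainder
    of the derivative with N lowered by one, so induction and the mean value theorem suffice; the
    factor 1/N! of the sharp bound is given up. *)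
Lemma taylor_bound f N (C rho : R) :
  (forall j (u : R), (j < N)%N -> `|u| < rho -> is_derive u 1 (f j) (f j.+1 u)) ->
  (forall u : R, `|u| < rho -> `|f N u| <= C) ->
  forall u : R, `|u| < rho -> `|f 0%N u - (taylor_poly f N).[u]| <= C * `|u| ^+ N.
Proof.
elim: N f => [|N IH] f df fC u urho.
  by rewrite /taylor_poly poly_def big_ord0 horner0 subr0 expr0 mulr1 fC.
have C0 : 0 <= C by apply: le_trans (fC u urho).
pose g x := f 0%N x - (taylor_poly f N.+1).[x].
pose dg x := f 1%N x - (taylor_poly (fun j => f j.+1) N).[x].
have dgE (x : R) : `|x| < rho -> is_derive x 1 g (dg x).
  move=> xrho; apply: is_deriveB; first exact: df.
  by rewrite -deriv_taylor_poly; exact: is_derive_poly.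
have dgC (x : R) : `|x| < rho -> `|dg x| <= C * `|x| ^+ N.
  by move=> xrho; apply: (IH (fun j => f j.+1)) => // j y jN; exact: df.
have g0 : g 0 = 0.
  rewrite /g horner_coef0 coef_poly/= fact0 divr1 subrr//.
have gc a b : (forall x, a <= x <= b -> `|x| < rho) ->
    {within `[a, b], continuous g}.
  move=> ab; apply: derivable_within_continuous => x.
  by rewrite in_itv/= => /ab /dgE [].
have [c cu gE] : exists2 c, `|c| <= `|u| & g u = dg c * u.
  have [u0|u0] := leP 0 u.
    have ab x : 0 <= x <= u -> `|x| < rho.
      by move=> /andP[x0 xu]; rewrite ger0_norm// (le_lt_trans xu)// -(ger0_norm u0).
    have [||c] := @MVT_segment _ g dg 0 u u0.
    - by move=> x; rewrite in_itv/= => /andP[x0 xu]; apply/dgE/ab; rewrite !ltW.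
    - exact: gc.
    rewrite in_itv/= g0 !subr0 => /andP[c0 cu] ->; exists c => //.
    by rewrite !ger0_norm.
  have ab x : u <= x <= 0 -> `|x| < rho.
    move=> /andP[ux x0]; rewrite ler0_norm//; apply: le_lt_trans urho.
    by rewrite ltr0_norm// lerN2.
  have [||c] := @MVT_segment _ g dg u 0 (ltW u0).
  - by move=> x; rewrite in_itv/= => /andP[x0 xu]; apply/dgE/ab; rewrite !ltW.
  - exact: gc.
  rewrite in_itv/= g0 !sub0r => /andP[uc c0] gE; exists c.
    by rewrite ler0_norm// ltr0_norm// lerN2.
  by apply: oppr_inj; rewrite gE mulrN.
rewrite -/(g u) gE normrM exprSr mulrA ler_wpM2r//.
apply: (le_trans (dgC _ (le_lt_trans cu urho))).
by rewrite ler_wpM2l// lerXn2r.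
Qed.

End Taylor1.

(** * Several variables, one coordinate direction at a time *)

Section TaylorCurve.
Context {R : realType} {l : nat}.
Local Notation E := ('rV[R]_l * R)%type.
Implicit Types (D : set E) (f : E -> R) (o : option 'I_l) (z : E).

Lemma smooth_on_partial D f o : smooth_on D f -> smooth_on D (partial o f).
Proof. by move=> sf w z Dz; have := sf (rcons w o) z Dz; rewrite foldr_rcons. Qed.

Lemma smooth_on_iter D f o j : smooth_on D f -> smooth_on D (iter j (partial o) f).
Proof. by move=> sf; elim: j => // j IH; exact: smooth_on_partial. Qed.

Lemma smooth_on_continuous D f z : smooth_on D f -> D z -> {for z, continuous f}.
Proof. by move=> sf Dz; have [] := sf [::] z Dz. Qed.

Lemma is_derive_line D f o z (u : R) : smooth_on D f -> D (z + u *: coord_dir o) ->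
  is_derive u 1 (fun u => f (z + u *: coord_dir o))
    (partial o f (z + u *: coord_dir o)).
Proof.
move=> sf /(sf [::]) [_ /(_ o)] /= df.
have lineE : (fun h : R => h^-1 *: (f (z + (h *: 1 + u) *: coord_dir o) -
      f (z + u *: coord_dir o))) =
    (fun h : R => h^-1 *: (f (h *: coord_dir o + (z + u *: coord_dir o)) -
      f (z + u *: coord_dir o))).
  apply/funext => h; congr (_ *: (f _ - _)).
  by rewrite [h *: 1]mulr1 scalerDl addrCA.
split; first by rewrite /derivable /= /shift; rewrite lineE.
by rewrite /partial /derive /= lineE.
Qed.

Lemma near_line z o (P : E -> Prop) : (\forall z' \near z, P z') ->
  exists2 rho : R, 0 < rho & \forall q \near z, forall u : R, `|u| < rho ->
    P (q + u *: coord_dir o).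
Proof.
move=> nP.
have : (fun qu : E * R => qu.1 + qu.2 *: (coord_dir o : E)) qu @[qu --> (z, 0)] --> z.
  have := @cvgD _ E _ (nbhs (z, 0 : R)) _ fst
    (fun qu => qu.2 *: (coord_dir o : E)) z (0 *: (coord_dir o : E)).
  rewrite scale0r addr0; apply; first exact: cvg_fst.
  by rewrite -[X in _ --> X](scale0r (coord_dir o : E)); apply: cvgZr_tmp; exact: cvg_snd.
move=> /(_ _ nP) [[Q B] /= [nQ /nbhs_ballP[rho /= rho0 Brho]] QB].
exists rho => //; apply: filterS nQ => q Qq u urho.
by apply: (QB (q, u)); split=> //; apply: Brho; rewrite /ball/= sub0r normrN.
Qed.

(** The bound is uniform in the base point q, which will itself move with t; C bounds the N-th
    derivative near z by continuity. *)
Lemma taylor_line D f o z N : open D -> smooth_on D f -> D z ->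
  exists C rho, 0 < rho /\ \forall q \near z, forall u : R, `|u| < rho ->
    `|f (q + u *: coord_dir o) -
      \sum_(j < N) iter j (partial o) f q / j`!%:R * u ^+ j| <= C * `|u| ^+ N.
Proof.
move=> oD sf Dz; pose fN := iter N (partial o) f.
have sfN : smooth_on D fN by exact: smooth_on_iter.
pose C := `|fN z| + 1.
have nD : \forall z' \near z, D z' /\ `|fN z'| <= C.
  near=> z'; split; first by near: z'; exact: open_nbhs_nbhs.
  apply/ltW; near: z'.
  apply: (cvgr_lt _ (cvg_norm (smooth_on_continuous sfN Dz))).
  by rewrite ltrDl.
have [rho rho0 H] := near_line o nD.
exists C, rho; split=> //; apply: filterS H => q H u urho.
pose phi j (u : R) := iter j (partial o) f (q + u *: coord_dir o).
have phi_derive j (x : R) : (j < N)%N -> `|x| < rho ->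
    is_derive x 1 (phi j) (phi j.+1 x).
  move=> _ xrho; apply: (@is_derive_line D); first exact: smooth_on_iter.
  by have [] := H x xrho.
have phi_bound (x : R) : `|x| < rho -> `|phi N x| <= C.
  by move=> xrho; have [] := H x xrho.
apply: le_trans (taylor_bound phi_derive phi_bound urho).
rewrite le_eqVlt; apply/orP; left; apply/eqP.
congr (`|_ - _|); rewrite horner_poly; apply: eq_bigr => j _.
by rewrite /phi scale0r addr0.
Unshelve. all: by end_near. Qed.

(** Listing the directions allows them to be peeled off from the right, so that one-variable Taylor
    expansions replace the multivariate one. *)
Definition curve z (s : seq (option 'I_l)) (u : option 'I_l -> R -> R) (t : R) : E :=
  z + \sum_(o <- s) u o t *: coord_dir o.

Lemma curve_rcons z s o u t :
  curve z (rcons s o) u t = curve z s u t + u o t *: coord_dir o.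
Proof. by rewrite /curve -cats1 big_cat big_seq1 addrA. Qed.

Lemma curve_cvg z s u d : 0 < d -> (forall o, powO d (u o)) ->
  curve z s u @ (0 : R)^'+ --> z.
Proof.
move=> d0 uO; elim/last_ind: s => [|s o IH].
  rewrite (_ : curve z [::] u = fun=> z); first exact: cvg_cst.
  by apply/funext => t; rewrite /curve big_nil addr0.
rewrite (_ : curve z (rcons s o) u = fun t => curve z s u t + u o t *: coord_dir o).
  rewrite -[X in _ --> X]addr0; apply: cvgD => //.
  rewrite -[X in _ --> X](scale0r (coord_dir o : E)); apply: cvgZr_tmp.
  exact: powO_cvg0 (uO o).
by apply/funext => t; exact: curve_rcons.
Qed.

(** N is chosen with d N > 1, which makes the remainder o(t). It depends on d only, so two
    amplitudes u and u' can share the same expansion. *)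
Lemma curve_taylor D f z s o d : open D -> smooth_on D f -> D z ->
  0 < d -> exists N, forall u, (forall o, powO d (u o)) ->
  meq (fun t => f (curve z (rcons s o) u t))
    (fun t => \sum_(j < N) iter j (partial o) f (curve z s u t) / j`!%:R * u o t ^+ j).
Proof.
move=> oD sf Dz d0; pose N := (Num.trunc d^-1).+1; exists N => u uO.
have dN : 1 < d * N%:R by rewrite -ltr_pdivrMl// mulr1 truncnS_gt.
have [C [rho [rho0 H]]] := taylor_line o N oD sf Dz.
apply: (negl_le _ (powO_negl dN (powOZ C (powOX N (uO o))))).
have H' := @curve_cvg z s u d d0 uO _ H.
have urho : \forall t \near (0 : R)^'+, `|u o t| < rho.
  have /cvgrPdist_lt/(_ _ rho0) := powO_cvg0 d0 (uO o).
  by apply: filterS => t; rewrite sub0r normrN.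
apply: filterS2 urho H' => t ut /(_ _ ut).
rewrite curve_rcons => /le_trans; apply.
by rewrite -normrX; apply: le_trans (ler_norm _) _; rewrite !normrM normr_id.
Qed.

Lemma curve_pux D f z s u d : open D -> smooth_on D f -> D z ->
  0 < d -> (forall o, powO d (u o)) -> (forall o, pux (u o)) ->
  pux (fun t => f (curve z s u t)).
Proof.
move=> oD sf Dz d0 uO pu; elim/last_ind: s f sf => [|s o IH] f sf.
  by under eq_fun do rewrite /curve big_nil; exact: pux_cst.
have [N /(_ _ uO)/meq_sym H] := curve_taylor s o oD sf Dz d0.
apply: (pux_meq H); apply: pux_sum => j _; apply: puxM; last exact: puxX.
by apply: puxM (pux_cst _); apply: IH; exact: smooth_on_iter.
Qed.

Lemma curve_meq D f z s u u' d : open D -> smooth_on D f -> D z ->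
  0 < d -> (forall o, powO d (u o)) -> (forall o, pux (u o)) ->
  (forall o, powO d (u' o)) -> (forall o, meq (u o) (u' o)) ->
  meq (fun t => f (curve z s u t)) (fun t => f (curve z s u' t)).
Proof.
move=> oD sf Dz d0 uO pu u'O uu'; elim/last_ind: s f sf => [|s o IH] f sf.
  by apply: meq_near; near=> t; rewrite /curve !big_nil.
have pu' o' := pux_meq (uu' o') (pu o').
have [N HN] := curve_taylor s o oD sf Dz d0.
apply: meq_trans (HN _ uO) _; apply: meq_trans (meq_sym (HN _ u'O)).
apply: meq_sum => j _.
have sfj : smooth_on D (iter j (partial o) f) by exact: smooth_on_iter.
apply: meqM.
- by apply: bndM (bnd_cst _); exact/pux_bnd/(curve_pux _ oD sfj Dz d0 uO pu).
- exact/bndX/pux_bnd.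
- apply: meqM; [|exact: bnd_cst|exact: IH|exact: meq_refl].
  exact/pux_bnd/(curve_pux _ oD sfj Dz d0 uO pu).
- by apply: meqX => //; exact: pux_bnd.
Unshelve. all: by end_near. Qed.

(** Expanding in the last direction leaves coefficients that are iterated derivatives of f, to which
    the vanishing hypothesis passes; after the last direction only the value at z remains. *)
Lemma curve_flat D f z (s : seq 'I_l) u d : open D -> smooth_on D f -> D z ->
  0 < d -> (forall o, powO d (u o)) -> (forall o, pux (u o)) -> uniq s ->
  (forall av : 'I_l -> nat,
    foldr (fun i => iter (av i) (partial (Some i))) f s z = 0) ->
  negl (fun t => f (curve z (map Some s) u t)).
Proof.
move=> oD sf Dz d0 uO pu; elim/last_ind: s f sf => [|s i IH] f sf us f0.
  have := f0 (fun=> 0%N) => /= fz.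
  by under eq_fun do rewrite /curve big_nil addr0 fz; exact: negl0.
rewrite map_rcons.
have [N /(_ _ uO) HN] := curve_taylor (map Some s) (Some i) oD sf Dz d0.
move: us; rewrite rcons_uniq => /andP[si us].
suff : negl (fun t => \sum_(j < N) iter j (partial (Some i)) f
    (curve z (map Some s) u t) / j`!%:R * u (Some i) t ^+ j).
  by move=> h; apply: negl_near (neglD HN h); near=> t; ring.
apply: negl_sum => j _.
have bu : bnd (fun t => (j`!%:R)^-1 * u (Some i) t ^+ j).
  exact: bndM (bnd_cst _) (bndX _ (pux_bnd (pu _))).
under eq_fun do rewrite -mulrA; apply: neglM bu.
apply: IH => //; first exact: smooth_on_iter.
(* The multi-index gets the value j at i; since i does not occur in s, the other derivatives are
   unaffected. *)
move=> av; pose av' k := if k == i then (j : nat) else av k.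
rewrite -[RHS](f0 av') foldr_rcons {2}/av' eqxx; congr (_ z).
elim: s si {us f0 HN} => //= k s IHs; rewrite inE negb_or => /andP[ik /IHs ->].
by rewrite /av' eq_sym (negbTE ik).
Unshelve. all: by end_near. Qed.

End TaylorCurve.

(** * Little-oh polynomials and their order *)

Section LittleOhPolynomials.
Context {R : realType}.
Implicit Types (x y z : R -> R).

Section Coordinate.
Context {E : normedModType R}.
Variable phi : E -> R.
Hypotheses (phiD : forall u w, phi (u + w) = phi u + phi w)
  (phiZ : forall a u, phi (a *: u) = a * phi u)
  (phi_le : forall u, `|phi u| <= `|u|).

Let phi0 : phi 0 = 0.
Proof. by rewrite -(scale0r (0 : E)) phiZ mul0r. Qed.

Let phiB u w : phi (u - w) = phi u - phi w.
Proof. by rewrite phiD -scaleN1r phiZ mulN1r. Qed.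

Lemma littleo_coord (f : R -> E) : f =o_ (0^'+) id -> negl (phi \o f).
Proof.
move=> /eqoP h e e0; apply: filterS2 near0_gt (h e e0) => t t0 /=.
by rewrite (gtr0_norm t0); apply: le_trans.
Qed.

Lemma lop_equiv_coord (f g : R -> E) : lop_equiv f g -> meq (phi \o f) (phi \o g).
Proof.
by move=> [_ /littleo_coord]; apply: negl_near; near=> t; rewrite /= phiB.
Unshelve. all: by end_near. Qed.

(** A linear form of norm at most 1 covers both the identity of R and each coordinate of a
    product. *)
Lemma lop_coord (U : set E) (f : R -> E) : is_lop U f ->
  exists2 z, gpoly0 z & meq (phi \o f) (fun t => phi (f 0) + z t).
Proof.
move=> [_ [k [a [al [a0 /littleo_coord h]]]]].
exists (fun t => \sum_(i < k) phi (tnth al i) * t `^ tnth a i).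
  elim: k a al a0 {h} => [|k IH] a al a0.
    by apply: gpoly0_ext gpoly0_0 => t _; rewrite big_ord0.
  pose a' := [tuple tnth a (lift ord0 i) | i < k].
  pose al' := [tuple tnth al (lift ord0 i) | i < k].
  have a'0 i : 0 < tnth a' i by rewrite tnth_mktuple.
  apply: gpoly0_ext (gpoly0D (gpoly0_mono (phi (tnth al ord0)) (a0 ord0)) (IH a' al' a'0)).
  move=> t _; rewrite big_ord_recl; congr (_ + _).
  by apply: eq_bigr => i _; rewrite !tnth_mktuple.
apply: negl_near h; near=> t; rewrite /= phiB /puiseux phiD; congr (_ - (_ + _)).
elim/big_rec2 : _ => // i u w _ <-; rewrite phiD phiZ mulrC//.
Unshelve. all: by end_near. Qed.

End Coordinate.

Lemma lop_pux (U : set R) x : is_lop U x ->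
  exists2 z, gpoly0 z & meq x (fun t => x 0 + z t).
Proof. exact: (@lop_coord _ id). Qed.

(** Serves to turn computed germs back into little-oh polynomials. The convergence to x 0 identifies
    the constant term of the series with the value at 0. *)
Lemma pux_lop (U : set R) x e : 0 < e -> (forall t, 0 <= t < e -> U (x t)) ->
  pux x -> x t @[t --> 0^'+] --> x 0 -> is_lop U x.
Proof.
move=> e0 xU px xc; split; first by exists e.
have [y gy xy] := px; have [c [z gz yz]] := gpoly_split gy.
have cE : c = x 0.
  have [d /andP[d0 d1] zO] := gpoly0_powO gz.
  apply: (@cvg_lim_eq _ x); last exact: xc.
  apply/subr_cvg0; apply: (powO_cvg0 d0).
  apply: powO_near (powOD zO (powO_le d1 (negl_powO1 xy))).
  by apply: filterS near0_gt => t t0; rewrite yz//; ring.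
have [p p0 zE] := gz.
exists (size p), [tuple of map fst (in_tuple p)], [tuple of map snd (in_tuple p)]; split.
  move=> i; rewrite tnth_map (tnth_nth (0, 0)) /=.
  by move/allP: p0; apply; rewrite mem_nth.
apply/neglP; apply: negl_near xy; apply: filterS near0_gt => t t0.
rewrite yz// cE zE//; congr (_ - (_ + _)).
rewrite /peval (big_nth (0, 0)) big_mkord; apply: eq_bigr => i _.
by rewrite !tnth_map !(tnth_nth (0, 0)) mulrC.
Qed.

End LittleOhPolynomials.

(** * The lexicographic order as eventual comparison *)

Section Order.
Context {R : realType}.
Implicit Types (x y z : R -> R) (s a : seq R).

Lemma olt_mono (b c : R) q : 0 < c -> b <= 1 -> gpoly0 q ->
  olt (fun=> 0) (fun t => t `^ b * (c + q t)).
Proof.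
move=> c0 b1 gq; have c2 : 0 < c / 2 by rewrite divr_gt0.
exists (c / 2) => //.
have [d /andP[d0 _] /(powO_cvg0 d0)/cvgrPdist_le/(_ _ c2)] := gpoly0_powO gq.
apply: filterS3 near0_gt (near0_lt ltr01) => t t0 /ltW t1.
rewrite sub0r normrN ler_norml add0r => /andP[q1 _].
have tb : t <= t `^ b.
  by rewrite -[leLHS](powRr1 (ltW t0)) ger_powR// t0.
rewrite mulrC; apply: ler_pM => //; [exact: ltW|exact: ltW|lra].
Qed.

(** The first differing coefficients give the leading term of the difference; its exponent is at
    most 1, hence a gap linear in t. *)
Lemma lex_olt a s1 s2 : sorted <%R a -> all (fun b => b <= 1) a ->
  size s1 = size a -> size s2 = size a -> ~~ (s2 <= s1 :> seqlexi R)%O ->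
  olt (peval (zip a s1)) (peval (zip a s2)).
Proof.
elim: a s1 s2 => [|b a IH] [|c1 s1] [|c2 s2]//= ba /andP[b1 a1] [s1a] [s2a].
rewrite lexi_cons negb_and negb_imply -ltNge.
have pE c s t : peval ((b, c) :: zip a s) t = c * t `^ b + peval (zip a s) t.
  by rewrite /peval big_cons.
move=> s12; case: (ltgtP c1 c2) s12 => [c12 _|//|-> /= s12].
  (* As a is strictly increasing, the tail keeps positive exponents after t^b is factored out. *)
  have gtail s : size s = size a -> gpoly0 (fun t => t `^ (- b) * peval (zip a s) t).
    move=> sa; exists [seq (c.1 - b, c.2) | c <- zip a s].
      rewrite all_map; apply/allP => c cas /=; rewrite subr_gt0.
      have /allP : all (>%R^~ b) a.
        by move: ba; rewrite path_sortedE; [case/andP|exact: lt_trans].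
      apply; rewrite -[a in X in _ \in X](@unzip1_zip _ _ a s) ?sa//.
      exact: map_f.
    move=> t t0; rewrite /peval big_map mulr_sumr; apply: eq_bigr => c _ /=.
    by rewrite mulrCA -powRD_gt0// addrC.
  have gq := gpoly0D (gtail s2 s2a) (gpoly0M (gtail s1 s1a) (gpoly_cst (-1))).
  have c21 : 0 < c2 - c1 by rewrite subr_gt0.
  have [e e0 h] := olt_mono c21 b1 gq; exists e => //.
  apply: filterS2 near0_gt h => t t0; rewrite !pE add0r => h.
  rewrite -lerBrDl; apply: le_trans h _; rewrite le_eqVlt; apply/orP; left; apply/eqP.
  have tb : t `^ b * t `^ (- b) = 1 by rewrite -powRD_gt0// subrr powRr0.
  by rewrite !mulrDr !mulrA tb; ring.
have [e e0 h] := IH _ _ (path_sorted ba) a1 s1a s2a s12; exists e => //.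
by apply: filterS h => t; rewrite !pE -addrA lerD2l.
Qed.

Lemma lex_ole a s1 s2 : sorted <%R a -> all (fun b => b <= 1) a ->
  size s1 = size a -> size s2 = size a -> (s1 <= s2 :> seqlexi R)%O ->
  ole (peval (zip a s1)) (peval (zip a s2)).
Proof.
move=> sa a1 s1a s2a s12; have [s21|s21] := boolP (s2 <= s1 :> seqlexi R)%O.
  have -> : s1 = s2 by apply/eqP; rewrite (@eq_le _ (seqlexi R)) s12.
  exact: ole_refl.
exact/olt_ole/lex_olt.
Qed.

Lemma peval_collect p a : uniq a -> all (fun c : R * R => c.1 \in a) p -> forall t,
  peval p t = peval (zip a [seq \sum_(c <- p | c.1 == b) c.2 | b <- a]) t.
Proof.
move=> ua pa t; rewrite /peval.
have -> (f : R -> R) : zip a [seq f b | b <- a] = [seq (b, f b) | b <- a].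
  by elim: (a) => //= b s ->.
rewrite big_map /=; under [RHS]eq_bigr do rewrite mulr_suml.
rewrite (exchange_big_dep xpredT)//=.
rewrite big_seq [RHS]big_seq; apply: eq_bigr => c cp.
under eq_bigl do rewrite eq_sym.
by rewrite -big_filter filter_pred1_uniq ?big_seq1//; exact: (allP pa).
Qed.

Lemma peval_le1 p : all (fun c : R * R => 0 < c.1) p ->
  meq (peval p) (peval [seq c <- p | c.1 <= 1]).
Proof.
elim: p => [_|c p IH /= /andP[c0 /IH {}IH]]; first exact: meq_refl.
case: leP => c1.
  have := meqD (meq_refl (fun t => c.2 * t `^ c.1)) IH; apply: negl_near; near=> t.
  by rewrite /peval !big_cons.
have cn : negl (fun t => c.2 * t `^ c.1) := powO_negl c1 (powO_mono _ _).
have := neglD cn IH; apply: negl_near; near=> t.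
by rewrite /peval !big_cons addrA.
Unshelve. all: by end_near. Qed.

Lemma puxeuxE (r : R) n (a alpha : n.-tuple R) (t : R) :
  puiseux r a alpha t = peval (zip (0 :: a) (r :: alpha)) t.
Proof.
rewrite /peval /= big_cons /= powRr0 mulr1 /puiseux; congr (_ + _).
rewrite (big_nth (0, 0)) size_zip !size_tuple minnn big_mkord.
apply: eq_bigr => i _; rewrite nth_zip ?size_tuple//= mulrC.
by rewrite !(tnth_nth 0).
Qed.

Lemma puiseux0 n (r : R) (a alpha : n.-tuple R) : (forall i, 0 < tnth a i) ->
  puiseux r a alpha 0 = r.
Proof.
move=> a0; rewrite /puiseux big1 ?addr0// => i _.
by rewrite powR0 ?scale0r// gt_eqF.
Qed.

(** Replaces the existential definition by a comparison of arbitrary representatives, the only form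
    of the order used in the analysis. *)
Lemma fermat_leP (U : set R) (x y : fermat U) : fermat_le x y <-> ole (repr x) (repr y).
Proof.
split.
  move=> [n [a [al [be [sa a01 [_ xE] [_ yE] xy]]]]].
  move/neglP in xE; move/neglP in yE.
  apply: ole_trans (meq_ole xE) _; apply: ole_trans _ (meq_ole (meq_sym yE)).
  (* Prepending the exponent 0 makes the standard part an ordinary first coefficient. *)
  have := @lex_ole (0 :: a) (std_part x :: al) (std_part y :: be).
  rewrite /= !size_tuple => /(_ _ _ erefl erefl xy) H e e0.
  have sa' : path <%R 0 a.
    rewrite path_sortedE ?sa ?andbT; last exact: lt_trans.
    by apply/allP => b /tnthP[i ->]; case/andP: (a01 i).
  have a1 : (0 <= 1 :> R) && all (fun b => b <= 1) a.
    rewrite ler01; apply/allP => b /tnthP[i ->]; case/andP: (a01 i) => //.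
  by have := H sa' a1 e e0; apply: filterS => t; rewrite !puxeuxE.
move=> xy.
have /asboolP lx := lopP (repr x); have /asboolP ly := lopP (repr y).
have [z [p p0 zE] xE] := lop_pux lx; have [w [q q0 wE] yE] := lop_pux ly.
pose p1 := [seq c <- p | c.1 <= 1]; pose q1 := [seq c <- q | c.1 <= 1].
(* Common exponents: all those at most 1 in either expansion, without repetition. A coefficient
   missing on one side becomes an empty sum, so zero. *)
pose S := sort <=%R (undup (map fst (p1 ++ q1))).
pose al := [seq \sum_(c <- p1 | c.1 == b) c.2 | b <- S].
pose be := [seq \sum_(c <- q1 | c.1 == b) c.2 | b <- S].
have uS : uniq S by rewrite sort_uniq undup_uniq.
have sS : sorted <%R S by rewrite sort_lt_sorted undup_uniq.
have memS b : (b \in S) = (b \in map fst (p1 ++ q1)).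
  by rewrite mem_sort mem_undup.
have S01 b : b \in S -> 0 < b <= 1.
  rewrite memS => /mapP[c + ->]; rewrite mem_cat !mem_filter.
  by move=> /orP[/andP[-> cp]|/andP[-> cp]]; rewrite andbT;
    [exact: (allP p0)|exact: (allP q0)].
have pS : all (fun c : R * R => c.1 \in S) p1.
  by apply/allP => c cp; rewrite memS map_f// mem_cat cp.
have qS : all (fun c : R * R => c.1 \in S) q1.
  by apply/allP => c cp; rewrite memS map_f// mem_cat cp orbT.
have expand (u : R -> R) r v : all (fun c : R * R => 0 < c.1) r ->
    all (fun c : R * R => c.1 \in S) [seq c <- r | c.1 <= 1] ->
    (forall t, 0 < t -> v t = peval r t) -> meq u (fun t => u 0 + v t) ->
    meq u (peval (zip (0 :: S)
      (u 0 :: [seq \sum_(c <- [seq c <- r | c.1 <= 1] | c.1 == b) c.2 | b <- S]))).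
  move=> r0 rS vE uE; apply: meq_trans uE _.
  apply: (@meq_trans _ (fun t => u 0 + peval r t)).
    by apply: meq_near; apply: filterS near0_gt => t t0; rewrite vE.
  apply: meq_trans (meqD (meq_refl (fun=> u 0)) (peval_le1 r0)) _.
  apply: meq_near; near=> t; rewrite (peval_collect uS rS).
  by rewrite [RHS]/peval /= big_cons /= powRr0 mulr1.
have {}xE := expand _ _ _ p0 pS zE xE; have {}yE := expand _ _ _ q0 qS wE yE.
have a0 : all (fun b => b <= 1) (0 :: S).
  by apply/allP => b; rewrite inE => /predU1P[->//|/S01/andP[]].
have s0 : sorted <%R (0 :: S).
  rewrite /= path_sortedE ?sS ?andbT; last exact: lt_trans.
  by apply/allP => b /S01/andP[].
exists (size S), (in_tuple S),
  (map_tuple (fun b => \sum_(c <- p1 | c.1 == b) c.2) (in_tuple S)),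
  (map_tuple (fun b => \sum_(c <- q1 | c.1 == b) c.2) (in_tuple S)).
have S0 i : 0 < tnth (in_tuple S) i <= 1 by apply: S01; rewrite mem_tnth.
have S0' i : 0 < tnth (in_tuple S) i by case/andP: (S0 i).
split=> //.
- split; first by rewrite puiseux0.
  apply/neglP; apply: negl_near xE; near=> t; by rewrite puxeuxE.
- split; first by rewrite puiseux0.
  apply/neglP; apply: negl_near yE; near=> t; by rewrite puxeuxE.
rewrite leNgt; apply/negP => yx.
have yx' : ~~ (std_part x :: al <= std_part y :: be :> seqlexi R)%O by rewrite -ltNge.
have := lex_olt s0 a0 _ _ yx'; rewrite /= !size_map => /(_ erefl erefl) h.
apply: (ole_olt _ h); apply: ole_trans (meq_ole (meq_sym xE)) _.
exact: ole_trans xy (meq_ole yE).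
Unshelve. all: by end_near. Qed.

End Order.

(** * Expansion of the quasi-standard function *)

Section Quotient.
Context {R : realType} {E : normedModType R} {U : set E}.
Local Open Scope quotient_scope.

Lemma fermat_eqP (x y : fermat U) : x = y <-> lop_equiv (repr x) (repr y).
Proof.
split=> [->|xy]; first exact: lop_equiv_refl.
by rewrite -[x]reprK -[y]reprK; apply/eqmodP; apply/asboolP.
Qed.

Lemma repr_pi (x : lop U) : lop_equiv (repr (\pi_(fermat U) x)) x.
Proof.
by have /eqmodP/asboolP : \pi_(fermat U) (repr (\pi_(fermat U) x)) = \pi_(fermat U) x
  by rewrite reprK.
Qed.

Lemma fermat_lop (x : fermat U) : is_lop U (repr x).
Proof. by have /asboolP := lopP (repr x). Qed.

Lemma fermat_of_lop (x : R -> E) : is_lop U x ->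
  exists X : fermat U, lop_equiv (repr X) x.
Proof.
by move=> lx; exists (\pi_(fermat U) (Lop (asboolT lx)));
  exact: repr_pi.
Qed.

End Quotient.

(** * Smooth functions along little-oh paths *)

Section Composition.
Context {R : realType} {l : nat}.
Local Notation E := ('rV[R]_l * R)%type.
Implicit Types (w : R -> E) (o : option 'I_l) (f : E -> R).

Definition coord o (z : E) : R := if o is Some i then z.1 0 i else z.2.

Lemma coordD o z z' : coord o (z + z') = coord o z + coord o z'.
Proof. by case: o => [i|] //=; rewrite mxE. Qed.

Lemma coordZ o a z : coord o (a *: z) = a * coord o z.
Proof. by case: o => [i|] //=; rewrite mxE. Qed.

Lemma norm_entry_le (u : 'rV[R]_l) i : `|u 0 i| <= `|u|.
Proof.
rewrite [leRHS]mx_normrE.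
exact: (le_bigmax _ (fun ij : 'I_1 * 'I_l => `|u ij.1 ij.2|) (0, i)).
Qed.

Lemma coord_le o z : `|coord o z| <= `|z|.
Proof.
rewrite prod_normE le_max; case: o => [i|] /=; last by rewrite lexx orbT.
by rewrite norm_entry_le.
Qed.

Definition displ w o (t : R) := coord o (w t) - coord o (w 0).

(** Using only the V-directions freezes the last coordinate, the situation in which [curve_flat] is
    applied. *)
Lemma curve_displ_fst w t :
  curve (w 0) (map Some (enum 'I_l)) (displ w) t = ((w t).1, (w 0).2).
Proof.
rewrite /curve big_map /=.
have -> (s : seq 'I_l) : \sum_(i <- s) displ w (Some i) t *: (delta_mx 0 i, 0) =
    (\sum_(i <- s) displ w (Some i) t *: delta_mx 0 i, 0) :> E.
  elim/big_rec2 : _ => // i u _ _ ->; congr pair; rewrite /= ?addr0//.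
  by rewrite scaler0.
congr pair; rewrite /= ?addr0// big_enum/=.
apply/rowP => i; rewrite !mxE summxE (bigD1 i)//= big1 ?addr0; last first.
  by move=> j ji; rewrite !mxE eqxx/= eq_sym (negbTE ji) mulr0.
by rewrite !mxE !eqxx mulr1 /displ/= subrKC.
Qed.

(** Every path is the curve of its own coordinate displacements, so the results on [curve] apply to
    all representatives. *)
Lemma curve_displ w t :
  curve (w 0) (rcons (map Some (enum 'I_l)) None) (displ w) t = w t.
Proof.
have wE : w t = ((w t).1, (w t).2) by case: (w t).
rewrite curve_rcons curve_displ_fst [RHS]wE.
congr pair; rewrite /= ?scaler0 ?addr0//.
by rewrite [_ *: _]mulr1 /displ /= subrKC.
Qed.

Definition pux_curve w := forall o, exists2 z, gpoly0 z & meq (displ w o) z.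

Lemma lop_pux_curve D w : is_lop D w -> pux_curve w.
Proof.
move=> lw o; have [z gz wz] := lop_coord (coordD o) (coordZ o) (coord_le o) lw.
exists z => //; apply: negl_near wz; near=> t; rewrite /displ/=; ring.
Unshelve. all: by end_near. Qed.

Lemma pux_curve_pux w o : pux_curve w -> pux (displ w o).
Proof. by move=> /(_ o)[z gz wz]; exists z => //; exact: gpoly0W. Qed.

Lemma pux_curve_powO w : pux_curve w ->
  exists2 d, 0 < d <= 1 & forall o, powO d (displ w o).
Proof.
move=> pw; pose A i := displ w (nth None (enum {: option 'I_l}) i).
have [|d d01 dA] := @powO_common _ (size (enum {: option 'I_l})) A.
  move=> i; have [z gz wz] := pw (nth None (enum {: option 'I_l}) i).
  have [d /andP[d0 d1] zO] := gpoly0_powO gz; exists d; first by rewrite d0.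
  apply: powO_near (powOD zO (powO_le d1 (negl_powO1 wz))); near=> t.
  rewrite /A; ring.
exists d => // o; have := dA (index o (enum {: option 'I_l})).
by rewrite index_mem mem_enum /A nth_index ?mem_enum//; apply.
Unshelve. all: by end_near. Qed.

Lemma pux_curve_cvg w : pux_curve w -> w @ (0 : R)^'+ --> w 0.
Proof.
move=> /pux_curve_powO[d /andP[d0 _] uO].
have := @curve_cvg _ _ (w 0) (rcons (map Some (enum 'I_l)) None) _ _ d0 uO.
by rewrite (_ : curve _ _ _ = w)//; apply/funext => t; exact: curve_displ.
Qed.

Lemma comp_pux D f w : open D -> smooth_on D f -> D (w 0) -> pux_curve w ->
  pux (fun t => f (w t)).
Proof.
move=> oD sf Dw pw; have [d /andP[d0 _] uO] := pux_curve_powO pw.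
have := curve_pux (rcons (map Some (enum 'I_l)) None) oD sf Dw d0 uO
  (fun o => pux_curve_pux o pw).
by under eq_fun do rewrite curve_displ.
Qed.

Lemma comp_cvg D f w : smooth_on D f -> D (w 0) -> pux_curve w ->
  (fun t => f (w t)) @ (0 : R)^'+ --> f (w 0).
Proof.
move=> sf Dw pw; apply: (cvg_comp _ _ (pux_curve_cvg pw)).
exact: smooth_on_continuous sf Dw.
Qed.

Lemma comp_meq D f w w' : open D -> smooth_on D f -> D (w 0) -> pux_curve w ->
  w 0 = w' 0 -> (forall o, meq (displ w o) (displ w' o)) ->
  meq (fun t => f (w t)) (fun t => f (w' t)).
Proof.
move=> oD sf Dw pw ww0 ww; have [d /andP[d0 d1] uO] := pux_curve_powO pw.
have uO' o : powO d (displ w' o).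
  apply: powO_near (powOD (uO o) (powON (powO_le d1 (negl_powO1 (ww o))))).
  by near=> t; ring.
have := curve_meq (rcons (map Some (enum 'I_l)) None) oD sf Dw d0 uO
  (fun o => pux_curve_pux o pw) uO' ww.
apply: negl_near; near=> t; rewrite curve_displ ww0 curve_displ//.
Unshelve. all: by end_near. Qed.

End Composition.

(** * The expansion at a standard point, from the vanishing mixed derivatives *)

Section Expansion.
Context {R : realType} {l : nat}.
Local Notation E := ('rV[R]_l * R)%type.
Variables (U : set R) (V : set 'rV[R]_l) (h : E -> R) (v : R -> 'rV[R]_l).
Hypotheses (oU : open U) (oV : open V) (sh : smooth_on (V `*` U) h).
Hypotheses (Vv : V (v 0)) (lv : is_lop V v).

Lemma open_prod : open (V `*` U).
Proof.
rewrite openE => -[a b] [/= Va Ub]; exists (V, U) => //; split.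
  by apply: open_nbhs_nbhs; split.
by apply: open_nbhs_nbhs; split.
Qed.

Lemma last_derivE m : last_deriv m h = iter m (partial None) h.
Proof. by rewrite /last_deriv /mderiv; elim: (enum 'I_l) => //= i s ->. Qed.

Lemma pux_curve_cst r : pux_curve (fun t => (v t, r)).
Proof.
move=> [i|].
  have [z gz vz] := lop_coord (phi := fun u : 'rV[R]_l => u 0 i)
    (fun u w => mxE _ _ _ _) (fun a u => mxE _ _ _ _) (fun u => norm_entry_le u i) lv.
  by exists z => //; apply: negl_near vz; near=> t; rewrite /displ/=; ring.
exists (fun=> 0); first exact: gpoly0_0.
by apply: meq_near; near=> t; rewrite /displ/= subrr.
Unshelve. all: by end_near. Qed.

(** Expanding D^(0,j) h (v t, r) around v 0 produces only mixed derivatives of order j in the last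
    variable, all assumed zero. *)
Lemma mderiv_flat r j : U r ->
  (forall av, mderiv av j h (v 0, r) = 0) ->
  negl (fun t => iter j (partial None) h (v t, r)).
Proof.
move=> Ur flat; have pw := pux_curve_cst r.
have [d /andP[d0 _] uO] := pux_curve_powO pw.
have shj := @smooth_on_iter _ _ _ _ None j sh.
have Dz : (V `*` U) ((fun t => (v t, r)) 0) by [].
have := curve_flat open_prod shj Dz d0 uO (fun o => pux_curve_pux o pw)
  (enum_uniq 'I_l) flat.
by under eq_fun do rewrite curve_displ_fst/=.
Qed.

Lemma smooth_expansion r m : U r -> (0 < m)%N -> last_deriv m h (v 0, r) != 0 ->
  (forall av j, (0 < j < m)%N -> mderiv av j h (v 0, r) = 0) ->
  exists p k, expansion (fun t x => h (v t, x)) r m p k.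
Proof.
move=> Ur m0 hm flat; have pw := pux_curve_cst r.
have Dz : (V `*` U) (v 0, r) by [].
pose H j := iter j (partial None) h.
have sH j : smooth_on (V `*` U) (H j) by exact: smooth_on_iter.
have pH j : pux (fun t => H j (v t, r)) := comp_pux open_prod (sH j) Dz pw.
(* Taylor coefficients in the last variable, taken at the base point (v t, r), which moves with
   t. *)
pose p i t := H (m + i)%N (v t, r) / (m + i)`!%:R.
exists p, (H m (v 0, r) / m`!%:R); split=> //.
- by move=> i; apply: puxM (pux_cst _).
- rewrite /p addn0; apply: cvgMl; exact: (comp_cvg (sH m) Dz pw).
- by rewrite mulf_neq0 ?invr_eq0 ?pnatr_eq0 -?lt0n ?fact_gt0// /H -last_derivE.
- exact: pH 0%N.
move=> n; pose e t := \sum_(j < m | (0 < j)%N) `|H j (v t, r) / j`!%:R|.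
have [C [rho [rho0 HT]]] := taylor_line None (m + n.+1) open_prod sh Dz.
have HT' : \forall t \near (0 : R)^'+, forall u : R, `|u| < rho ->
    `|h ((v t, r) + u *: coord_dir None) - \sum_(j < m + n.+1)
      iter j (partial None) h (v t, r) / j`!%:R * u ^+ j| <= C * `|u| ^+ (m + n.+1).
  exact: (pux_curve_cvg pw HT).
(* The bound 1 on |u| lets e dominate the terms of degree 0 < j < m; rho / 2 turns a weak inequality
   into the strict one of [taylor_line]. *)
exists C, (Num.min 1 (rho / 2)), e; split.
- by rewrite lt_min ltr01 divr_gt0.
- apply: negl_sum => j j0; apply: (@negl_le _ _ (fun t => H j (v t, r) / j`!%:R)).
    by near=> t; rewrite normr_id.
  apply: neglM (bnd_cst _); apply: mderiv_flat => // av.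
  by apply: flat; rewrite j0 ltn_ord.
apply: filterS HT' => t HT' u; rewrite le_min => /andP[u1 urho].
have {}urho : `|u| < rho.
  by apply: le_lt_trans urho _; rewrite ltr_pdivrMr// ltr_pMr// ltr1n.
have := HT' u urho.
have -> : (v t, r) + u *: coord_dir None = (v t, r + u) :> E.
  by congr pair; rewrite /= ?scaler0 ?addr0// [_ *: _]mulr1.
rewrite big_split_ord /=.
have -> : \sum_(i < n.+1) iter (m + i) (partial None) h (v t, r) / (m + i)`!%:R *
    u ^+ (m + i) = psum m n p t u by [].
move: (psum m n p t u) => P.
(* As m is a successor, the term j = 0, which is F t r, splits off from the sum A of the
   intermediate terms. *)
case: m m0 {hm p pw HT HT'} flat @e => // m _ flat e.
rewrite big_ord_recl/= fact0 divr1 expr0 mulr1.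
set A := \sum_(i < m) _ => hA.
have Ae : `|A| <= e t.
  rewrite /e big_mkcond big_ord_recl/= add0r; apply: le_trans (ler_norm_sum _ _ _) _.
  apply: ler_sum => i _; rewrite normrM ler_piMr// normrX exprn_ile1//.
have -> : h (v t, r + u) - h (v t, r) - P =
  (h (v t, r + u) - (h (v t, r) + A + P)) + A by ring.
by apply: le_trans (ler_normD _ _) _; exact: lerD.
Unshelve. all: by end_near. Qed.

End Expansion.

(** * Back to the quotient *)

Section Assembly.
Context {R : realType}.

Lemma global_ivp_between (U : set R) (h : R -> R) F a b y A B :
  is_interval U -> expandable U h F ->
  pux a -> a t @[t --> 0^'+] --> A -> U A ->
  pux b -> b t @[t --> 0^'+] --> B -> U B -> ole a b ->
  pux y -> between (fun t => F t (a t)) (fun t => F t (b t)) y ->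
  exists c C, [/\ pux c, c t @[t --> 0^'+] --> C, U C & [/\ ole a c, ole c b &
    meq (fun t => F t (c t)) y]].
Proof.
move=> iU ex pa aA UA pb bB UB ab py [[ay yb]|[byy ya]].
  exact: global_ivp ex pa aA UA pb bB UB ab py ay yb.
have ex' : expandable U (fun x => - h x) (fun t x => - F t x).
  have [exE Fh hc] := ex; split=> r Ur.
  - by have [m [p [k ?]]] := exE r Ur; exists m, (fun i t => - p i t), (- k);
      exact: expansion_neg.
  - exact: cvgN (Fh r Ur).
  - exact: continuousN (hc r Ur).
have [c [C [pc cC UC [ac cb cE]]]] := global_ivp iU ex' pa aA UA pb bB UB ab
  (puxN py) (oleN ya) (oleN byy).
exists c, C; split=> //; split=> //.
by apply: negl_near (neglN cE); near=> t; ring.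
Unshelve. all: by end_near. Qed.

Lemma meq_cvg (f g : R -> R) (a : R) : meq f g ->
  f t @[t --> 0^'+] --> a -> g t @[t --> 0^'+] --> a.
Proof.
move=> /meq_sym fg fa; have fg0 := powO_cvg0 ltr01 (negl_powO1 fg).
rewrite (_ : g = fun t => f t + (g t - f t)).
  by have := cvgD fa fg0; rewrite addr0; apply.
by apply/funext => t /=; rewrite subrKC.
Qed.

Lemma lop_cvg (U : set R) (x : R -> R) : is_lop U x -> x t @[t --> 0^'+] --> x 0.
Proof.
move=> /lop_pux[z gz xE]; have [d /andP[d0 d1] zO] := gpoly0_powO gz.
apply/subr_cvg0; apply: (powO_cvg0 d0).
apply: powO_near (powOD zO (powO_le d1 (negl_powO1 xE))); near=> t; ring.
Unshelve. all: by end_near. Qed.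

Lemma is_lop_pux (U : set R) (x : R -> R) : is_lop U x -> pux x.
Proof.
move=> /lop_pux[z gz /meq_sym xE]; apply: pux_meq xE _.
exact/gpoly_pux/(gpolyD (gpoly_cst _))/gpoly0W.
Qed.

Lemma is_lop_domain {E : normedModType R} (U : set E) (x : R -> E) :
  is_lop U x -> U (x 0).
Proof. by move=> [[e e0 xU] _]; apply: xU; rewrite lexx. Qed.

Lemma between_fermat (U : set R) (a b y : fermat U) :
  fermat_between a b y <-> between (repr a) (repr b) (repr y).
Proof.
split=> -[[h1 h2]|[h1 h2]]; [left|right|left|right];
  by split; apply/fermat_leP.
Qed.

End Assembly.

Section Extension.
Context {R : realType} {l : nat} (U : set R) (V : set 'rV[R]_l)
  (h : 'rV[R]_l * R -> R) (v : fermat V).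
Hypotheses (oU : open U) (oV : open V) (sh : smooth_on (V `*` U) h).

(** Smoothness makes h \o w a little-oh polynomial, so the default of [insubd] is never taken. The
    representative w of the pair agrees only up to o(t) with the pair of representatives, which
    [comp_meq] absorbs. *)
Lemma repr_fermat_ext (x : fermat U) :
  repr (fermat_ext h (fermat_pair v x)) 0 = h (repr v 0, repr x 0) /\
  meq (repr (fermat_ext h (fermat_pair v x))) (fun t => h (repr v t, repr x t)).
Proof.
pose w := repr (fermat_pair v x).
have oD := open_prod oU oV.
have lw : is_lop (V `*` U) w := fermat_lop _.
have wE : lop_equiv w (fun t => (repr v t, repr x t)) := repr_pi _.
have w0 : w 0 = (repr v 0, repr x 0) by case: wE.
have Dw : (V `*` U) (w 0) := is_lop_domain lw.
have pw := lop_pux_curve lw.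
have lhw : is_lop [set: R] (h \o w).
  apply: (pux_lop ltr01) => //; first exact: comp_pux oD sh Dw pw.
  exact: comp_cvg sh Dw pw.
have [e0 eE] := repr_pi (insubd (Lop (asboolT (is_lop_cst (0 : R)))) (h \o w)).
have hwE : insubd (Lop (asboolT (is_lop_cst (0 : R)))) (h \o w) = h \o w :> (R -> R).
  by apply: insubdK; apply/asboolP.
rewrite hwE in e0 eE; split; first by rewrite -w0; exact: e0.
apply: meq_trans ((neglP _).2 eE) _.
apply: (comp_meq oD sh Dw pw w0) => o.
have := lop_equiv_coord (coordD o) (coordZ o) (coord_le o) wE.
by apply: negl_near; near=> t; rewrite /displ w0 /=; ring.
Unshelve. all: by end_near. Qed.

End Extension.

Theorem proposition41 (R : realType) (l : nat) (U : set R) (V : set 'rV[R]_l)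
    (h : 'rV[R]_l * R -> R) (v : fermat V) :
  open U -> connected U -> open V ->
  smooth_on (V `*` U) h ->
  inf_part v <> fermat_cst 0 ->
  (forall x : fermat U, exists2 m : nat,
     (0 < m)%N & last_deriv m h (std_part v, std_part x) != 0) ->
  (forall (x : fermat U) (m : nat),
     is_first_order h (std_part v, std_part x) m ->
     forall (av : 'I_l -> nat) (ax : nat), (0 < ax < m)%N ->
       mderiv av ax h (std_part v, std_part x) = 0) ->
  intermediate_value_property
    (fun x : fermat U => fermat_ext h (fermat_pair v x)).
Proof.
move=> oU cU oV sh _ hm flat a b [ab _] y gy.
have iU : is_interval U by exact/connected_intervalP.
have lv := fermat_lop v; have Vv := is_lop_domain lv.
pose F t x := h (repr v t, x).
have ex : expandable U (fun x => h (repr v 0, x)) F.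
  have Fh r : U r -> F t r @[t --> 0^'+] --> h (repr v 0, r).
    by move=> Ur; exact: (comp_cvg sh _ (pux_curve_cst lv r)).
  split=> // r Ur.
    (* The hypotheses are stated over the extension of U; constant paths transfer them to a standard
       point r. *)
    have lr : is_lop U (fun=> r).
      by apply: (pux_lop ltr01) => //; [exact: pux_cst|exact: cvg_cst].
    have [x [xr _]] := fermat_of_lop lr; rewrite -/(std_part x) in xr.
    have exm : exists m, (0 < m)%N && (last_deriv m h (repr v 0, r) != 0).
      by have [m m0] := hm x; rewrite xr => hm0; exists m; rewrite m0.
    have [m /andP[m0 hm0] mmin] := ex_minnP exm.
    exists m; apply: (smooth_expansion oU oV sh Vv lv Ur m0 hm0) => av j jm.
    have := flat x m; rewrite xr; apply => //; split=> // k k0 hk.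
    by apply: mmin; rewrite k0.
  have hc : {for (repr v 0, r), continuous h} by exact: smooth_on_continuous sh _.
  apply: (cvg_comp (fun x => (repr v 0, x)) h _ hc).
  exact: (cvg_pair (cvg_cst (repr v 0)) (@cvg_id _ (nbhs r))).
have gE x := repr_fermat_ext v oU oV sh x.
have la := fermat_lop a; have lb := fermat_lop b.
move/fermat_leP in ab; move/between_fermat in gy.
have {}gy := between_meq (gE a).2 (gE b).2 gy.
have ly := fermat_lop y.
have [c [C [pc cC UC [ac cb cE]]]] := global_ivp_between iU ex (is_lop_pux la)
  (lop_cvg la) (is_lop_domain la) (is_lop_pux lb) (lop_cvg lb) (is_lop_domain lb)
  ab (is_lop_pux ly) gy.
(* The germ c says nothing about its value at 0, while the standard part is read there; it is reset
   to the limit C. Openness of U then keeps c' in U on some [0, e). *)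
pose c' t := if t == 0 then C else c t.
have cc' : \forall t \near (0 : R)^'+, c t = c' t.
  by apply: filterS near0_gt => t t0; rewrite /c' gt_eqF.
have c'C : c' t @[t --> 0^'+] --> c' 0.
  by rewrite {2}/c' eqxx; apply: cvg_trans cC; apply: near_eq_cvg.
have [e e0 c'U] : exists2 e, 0 < e & forall t, 0 <= t < e -> U (c' t).
  have Uc : \forall t \near (0 : R)^'+, U (c t).
    by apply: cC; apply: open_nbhs_nbhs.
  have /nbhs_ballP[e /= e0 eU] := Uc.
  exists e => // t /andP[]; rewrite le_eqVlt => /predU1P[<- _|t0 te].
    by rewrite /c' eqxx.
  rewrite /c' gt_eqF//; apply: eU => //.
  by rewrite /ball/= sub0r normrN gtr0_norm.
have lc' : is_lop U c' := pux_lop e0 c'U (pux_meq (meq_near cc') pc) c'C.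
have [x [x0 /neglP xc']] := fermat_of_lop lc'.
have xc : meq (repr x) c := meq_trans xc' (meq_sym (meq_near cc')).
exists x.
  apply/between_fermat; left; split.
    exact: ole_trans ac (meq_ole (meq_sym xc)).
  exact: ole_trans (meq_ole xc) cb.
apply/fermat_eqP.
have lg := fermat_lop (fermat_ext h (fermat_pair v x)).
have gy' : meq (repr (fermat_ext h (fermat_pair v x))) (repr y).
  apply: meq_trans (gE x).2 _; apply: meq_trans _ cE.
  apply: (@meq_trans _ (fun t => h (repr v t, c' t))); last first.
    by apply: meq_near; apply: filterS cc' => t ->.
  have lw := is_lop_pair (repr v) (repr x).
  apply: (comp_meq (open_prod oU oV) sh (is_lop_domain lw) (lop_pux_curve lw)).
    by rewrite /= x0.
  move=> [i|]; first exact: meq_refl.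
  by apply: negl_near xc'; near=> t; rewrite /displ /= x0 opprB addrA subrK.
split; last exact/neglP.
(* Equality in the quotient also asks for equal values at 0; these are the limits of two germs that
   differ by o(t). *)
apply: (@cvg_lim_eq _ (repr y)); last exact: lop_cvg ly.
exact: meq_cvg gy' (lop_cvg lg).
Unshelve. all: by end_near. Qed.
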